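(* Suppose $n$ is an even integer with $t_1+t_3\leq n<t_2$, and put $K=k_1+k_2+k_3$, $N=\tfrac{n+1}{2}$. Then: (i) the $\mathfrak{BI}$-module $\mathscr M_n(x_1)\cap\mathscr M_n(x_3)$ is isomorphic to $W_1\oplus W_1$, where $W_1=O_{n-t_1-t_3}(k_1+k_2+N,\,-k_2-k_3-N,\,-N)^{((-1,1),(2\,3))}$; (ii) the $\mathfrak{BI}$-modules $\mathscr M_n(x_1)/(\mathscr M_n(x_1)\cap\mathscr M_n(x_3))$ and $\mathscr M_n/\mathscr M_n(x_3)$ are each isomorphic to $W_2\oplus W_2$, where $W_2=O_{t_3-1}(k_2,\,-K-n-1,\,-k_1)^{((1,-1),(2\,3))}$; (iii) the $\mathfrak{BI}$-modules $\mathscr M_n(x_3)/(\mathscr M_n(x_1)\cap\mathscr M_n(x_3))$ and $\mathscr M_n/\mathscr M_n(x_1)$ are each isomorphic to $W_3\oplus W_3$, where $W_3=O_{t_1-1}(k_2,\,-K-n-1,\,-k_3)^{((1,-1),(1\,2\,3))}$. Moreover, if $k_2\geq0$, then $W_1,W_2,W_3$ are irreducible and are isomorphic to $O_{n-t_1-t_3}(-k_1-k_2-N,\,N,\,-k_2-k_3-N)$, $O_{t_3-1}(k_2,\,k_1,\,K+n+1)$ and $O_{t_1-1}(K+n+1,\,k_3,\,k_2)$, respectively.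
   Context: Fix real numbers $k_1,k_2,k_3$. For $i=1,2,3$ let $R_i$ be the operator on functions on $\mathbb R^3$ replacing $x_i$ by $-x_i$, and $T_if=\frac{\partial f}{\partial x_i}+k_i\frac{f-R_if}{x_i}$ (Dunkl operators). Let $\sigma_1=\begin{pmatrix}0&1\\1&0\end{pmatrix}$, $\sigma_2=\begin{pmatrix}0&-\sqrt{-1}\\ \sqrt{-1}&0\end{pmatrix}$, $\sigma_3=\begin{pmatrix}1&0\\0&-1\end{pmatrix}$, and let $e_i$ act on $\mathbb C^2$ by $\sigma_i$. Tensor products are over $\mathbb R$; $\mathbb R[\cdots]_m$ denotes homogeneous polynomials of degree $m$. Let $\mathbf D=e_1\otimes T_1+e_2\otimes T_2+e_3\otimes T_3$ and $\mathscr M_n=\ker(\mathbf D|_{\mathbb C^2\otimes\mathbb R[x_1,x_2,x_3]_n})$. For $i=1,2,3$ set $t_i=-2k_i$ if $2k_i$ is an odd negative integer, and $t_i=\infty$ otherwise. For $i=1,2,3$, $\mathscr M_n(x_i)=\mathscr M_n\cap\bigoplus_{j=t_i}^n\mathbb C^2\otimes(x_i^j\cdot\mathbb R[x_p,x_q]_{n-j})$ where $\{p,q\}=\{1,2,3\}\setminus\{i\}$ (it is $\{0\}$ if $n<t_i$); it is a $\mathfrak{BI}$-submodule of $\mathscr M_n$. $\mathfrak{BI}$ is the unital associative $\mathbb C$-algebra generated by $X,Y,Z$ with relations saying that $\{X,Y\}-Z$, $\{Y,Z\}-X$, $\{Z,X\}-Y$ commute with $X,Y,Z$ ($\{A,B\}=AB+BA$).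 $\mathscr M_n$ is a $\mathfrak{BI}$-module via $X=(\sqrt{-1}\,e_1\otimes(x_3T_2-x_2T_3)+\tfrac12)R_2R_3+k_2R_3+k_3R_2$, $Y=(\sqrt{-1}\,e_2\otimes(x_1T_3-x_3T_1)+\tfrac12)R_1R_3+k_3R_1+k_1R_3$, $Z=(\sqrt{-1}\,e_3\otimes(x_2T_1-x_1T_2)+\tfrac12)R_1R_2+k_1R_2+k_2R_1$, operators composed right to left, $R_i$ acting on the polynomial factor. Twisting: for a $\mathfrak{BI}$-module $V$ and algebra automorphism $\varepsilon$, $V^\varepsilon$ is $V$ with action $x\cdot v=\varepsilon(x)v$. A permutation $\sigma\in\mathfrak S_3$ denotes the automorphism sending the generator with index $i$ in $(X,Y,Z)$ to the generator with index $\sigma(i)$; the sign automorphisms are $(1,-1)\colon X\mapsto X,Y\mapsto -Y,Z\mapsto -Z$; $(-1,1)\colon X\mapsto -X,Y\mapsto Y,Z\mapsto -Z$; $(-1,-1)\colon X\mapsto -X,Y\mapsto -Y,Z\mapsto Z$; a pair $(\epsilon,\sigma)$ denotes the composite $\epsilon\circ\sigma$. For $a,b,c\in\mathbb C$ and even $d\geq0$, $O_d(a,b,c)$ is the $\mathfrak{BI}$-module $\mathbb C^{d+1}$ in which, w.r.t. a basis $v_0,\dots,v_d$, $X$ acts by the lower bidiagonal matrix with diagonal $(\theta_0,\dots,\theta_d)$ and subdiagonal entries $1$, $Y$ by the upper bidiagonal matrix with diagonal $(\theta^*_0,\dots,\theta^*_d)$ and superdiagonal $(\varphi_1,\dots,\varphi_d)$,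 and $Z=\{X,Y\}-(2ab-c(d+1))$, where $\theta_i=\frac{(-1)^i(2a-d+2i)}{2}$, $\theta^*_i=\frac{(-1)^i(2b-d+2i)}{2}$, $\varphi_i=\frac{i(d+1-2i-2a-2b-2c)}{2}$ ($i$ even), $\varphi_i=\frac{(i-d-1)(d+1-2i-2a-2b+2c)}{2}$ ($i$ odd). *)

(* Defs.v *)
From HB Require Import structures.
From mathcomp Require Import all_boot all_order all_algebra.
From mathcomp Require Import Rstruct.
From mathcomp Require Import complex.
From mathcomp Require Import mpoly.
Set Implicit Arguments.
Unset Strict Implicit.
Unset Printing Implicit Defensive.
Import GRing.Theory Num.Theory.
Local Open Scope ring_scope.

Notation RR := Rdefinitions.R.
Definition C : numClosedFieldType := complex RR.
Definition rC (x : RR) : C := (x%:C)%C.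
Definition iC : C := ('i)%C.

(* Polynomials in x_1,x_2,x_3 (indices 0,1,2) with complex coefficients.
   C^2 (x)_R R[x1,x2,x3] is identified with pairs of such polynomials. *)
Definition P := {mpoly C[3]}.
Definition E := (P * P)%type.

Definition kfun (k1 k2 k3 : RR) (i : 'I_3) : RR :=
  match nat_of_ord i with 0 => k1 | 1 => k2 | _ => k3 end.

Definition refl (i : 'I_3) (p : P) : P :=
  p \mPo [tuple (if j == i then - 'X_j else 'X_j) | j < 3].

(* division by x_i (exact on polynomials divisible by x_i, such as f - R_i f) *)
Definition divX (i : 'I_3) (p : P) : P :=
  \sum_(m <- msupp p | (0 < m i)%N) p@_m *: 'X_[(m - U_(i))%MM].

Definition dunkl (k : 'I_3 -> RR) (i : 'I_3) (p : P) : P :=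
  mderiv i p + rC (k i) *: divX i (p - refl i p).

Definition liftE (f : P -> P) (v : E) : E := (f v.1, f v.2).

Definition sigma (i : 'I_3) (v : E) : E :=
  match nat_of_ord i with
  | 0 => (v.2, v.1)
  | 1 => ((- iC) *: v.2, iC *: v.1)
  | _ => (v.1, - v.2)
  end.

Definition dirac (k : 'I_3 -> RR) (v : E) : E :=
  \sum_(i < 3) sigma i (liftE (dunkl k i) v).

(* The generators X (g=0), Y (g=1), Z (g=2) of BI acting on C^2 (x) R[x] *)
Definition BIop (k : 'I_3 -> RR) (g : 'I_3) (v : E) : E :=
  let T := dunkl k in
  match nat_of_ord g with
  | 0 => let w := liftE (fun p => refl 1 (refl 2 p)) v in
         iC *: sigma 0 (liftE (fun p => 'X_2 * T 1 p - 'X_1 * T 2 p) w)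
         + (2%:R)^-1 *: w
         + rC (k 1) *: liftE (refl 2) v + rC (k 2) *: liftE (refl 1) v
  | 1 => let w := liftE (fun p => refl 0 (refl 2 p)) v in
         iC *: sigma 1 (liftE (fun p => 'X_0 * T 2 p - 'X_2 * T 0 p) w)
         + (2%:R)^-1 *: w
         + rC (k 2) *: liftE (refl 0) v + rC (k 0) *: liftE (refl 2) v
  | _ => let w := liftE (fun p => refl 0 (refl 1 p)) v in
         iC *: sigma 2 (liftE (fun p => 'X_1 * T 0 p - 'X_0 * T 1 p) w)
         + (2%:R)^-1 *: w
         + rC (k 0) *: liftE (refl 1) v + rC (k 1) *: liftE (refl 0) v
  end.

Definition Mn (k : 'I_3 -> RR) (n : nat) (v : E) : Prop :=
  [/\ v.1 \is n.-homog, v.2 \is n.-homog & dirac k v = 0].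

Definition is_t (ki : RR) (t : nat) : Prop := odd t /\ 2%:R * ki = - t%:R.

(* M_n(x_i) for finite t_i = t:  M_n cap (+)_{j >= t} C^2 (x) x_i^j R[x_p,x_q]_{n-j} *)
Definition Mnx (k : 'I_3 -> RR) (n : nat) (i : 'I_3) (t : nat) (v : E) : Prop :=
  Mn k n v /\ forall m : 'X_{1..3}, (m i < t)%N -> v.1@_m = 0 /\ v.2@_m = 0.

(* V/U (U a submodule of the submodule V of C^2 (x) R[x]) is isomorphic, as a
   BI-module, to the module C^m on which the generators act by A 0, A 1, A 2:
   there is a surjective C-linear BI-module map V -> C^m with kernel U. *)
Definition subquot_iso (k : 'I_3 -> RR) (V U : E -> Prop) (m : nat)
    (A : 'I_3 -> 'M[C]_m) : Prop :=
  (forall g v, V v -> V (BIop k g v)) /\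
  exists phi : E -> 'cV[C]_m,
    [/\ forall (a : C) u v, V u -> V v -> phi (a *: u + v) = a *: phi u + phi v,
        forall w, exists2 v, V v & phi v = w,
        forall v, V v -> (phi v = 0 <-> U v) &
        forall g v, V v -> phi (BIop k g v) = A g *m phi v].

Definition Otheta (d : nat) (a : C) (i : nat) : C :=
  (-1) ^+ i * (2%:R * a - d%:R + 2%:R * i%:R) / 2%:R.
Definition Ophi (d : nat) (a b c : C) (i : nat) : C :=
  if odd i then
    (i%:R - d%:R - 1) * (d%:R + 1 - 2%:R * i%:R - 2%:R * a - 2%:R * b + 2%:R * c) / 2%:R
  else
    i%:R * (d%:R + 1 - 2%:R * i%:R - 2%:R * a - 2%:R * b - 2%:R * c) / 2%:R.
Definition OX (d : nat) (a : C) : 'M[C]_d.+1 :=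
  \matrix_(r, s) (if r == s then Otheta d a s
                  else if nat_of_ord r == s.+1 then 1 else 0).
Definition OY (d : nat) (a b c : C) : 'M[C]_d.+1 :=
  \matrix_(r, s) (if r == s then Otheta d b s
                  else if nat_of_ord s == r.+1 then Ophi d a b c s else 0).
Definition Omod (d : nat) (a b c : C) (g : 'I_3) : 'M[C]_d.+1 :=
  match nat_of_ord g with
  | 0 => OX d a
  | 1 => OY d a b c
  | _ => OX d a *m OY d a b c + OY d a b c *m OX d a
         - (2%:R * a * b - c * d.+1%:R)%:M
  end.

(* Twisting by the automorphism (eps, s) = eps o s: generator g acts as eps(s g) *)
Definition twist (m : nat) (eps : 'I_3 -> C) (s : 'I_3 -> 'I_3)
    (A : 'I_3 -> 'M[C]_m) (g : 'I_3) : 'M[C]_m := eps (s g) *: A (s g).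
Definition eps_p1m1 (g : 'I_3) : C := if g == 0 then 1 else -1.
Definition eps_m1p1 (g : 'I_3) : C := if nat_of_ord g == 1%N then 1 else -1.
Definition s23 (g : 'I_3) : 'I_3 :=
  match nat_of_ord g with 0 => 0 | 1 => 2%:R | _ => 1 end.
Definition s123 (g : 'I_3) : 'I_3 :=
  match nat_of_ord g with 0 => 1 | 1 => 2%:R | _ => 0 end.

Definition dsum2 (m : nat) (A : 'I_3 -> 'M[C]_m) (g : 'I_3) : 'M[C]_(m + m) :=
  block_mx (A g) 0 0 (A g).

Definition mx_iso (m : nat) (A B : 'I_3 -> 'M[C]_m) : Prop :=
  exists2 S : 'M[C]_m, S \in unitmx & forall g, S *m A g = B g *m S.

Definition mx_irreducible (m : nat) (A : 'I_3 -> 'M[C]_m) : Prop :=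
  (0 < m)%N /\
  forall Q : 'cV[C]_m -> Prop,
    Q 0 -> (forall (a : C) u v, Q u -> Q v -> Q (a *: u + v)) ->
    (forall g u, Q u -> Q (A g *m u)) ->
    (forall u, Q u -> u = 0) \/ (forall u, Q u).

(* Main.v *)
(* Since [n < t_2], Cauchy-Kovalevskaya extension along [x_2] identifies [M_n]
   with C^2 (x) R[x_1,x_3]_n. The matrix sigma_2 commutes with the transported
   action of BI, so its two eigenspaces give two copies of one module with basis
   x_1^a x_3^b, a + b = n, on which X and Z are bidiagonal and Y is tridiagonal.
   Since T_i x_i^{t_i} = 0 for i = 1, 3, the submodules M_n(x_1) and M_n(x_3) are
   spanned by the monomials with a >= t_1, resp. b >= t_3; rescaling the monomials
   yields the modules O_d.

   A homomorphism out of O_d(a',b',c') is determined by the image v of v_0: it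
   suffices that v is an eigenvector of Y, that Y acts correctly on (X - theta_0)v,
   and that prod (X - theta_i) kills v, because {X,{X,Y}} = Y + const + const X then
   determines Y on the whole chain. The module O_d(a,b,c) has a product-form
   eigenvector of Z (which for M_n comes from (x_1^2 + x_3^2)^{n/2}), and this gives
   nonzero maps into its twists from the modules named in the theorem. For
   irreducibility, nonvanishing phi_i lets one step downwards through the
   X-eigenvalues in a submodule, and the isomorphism of O_d(-a,b,-c) with a twist of
   O_d(a,b,c) reverses their order. *)
Require Import Defs.
From HB Require Import structures.
From mathcomp Require Import all_boot all_order all_algebra.
From mathcomp Require Import Rstruct complex mpoly.
From Stdlib Require Import Classical_Prop.
From mathcomp Require Import ring lra zify.
Set Implicit Arguments.
Unset Strict Implicit.
Unset Printing Implicit Defensive.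
Import GRing.Theory Num.Theory.
Local Open Scope ring_scope.

(** * The modules O_d in coordinates *)

(* [fX], [fY], [fZ] are the actions of X, Y, Z on coefficient sequences
   [u 0, ..., u d], see [Omod_vecn]. *)
Definition fX (d : nat) (a : C) (u : nat -> C) (i : nat) : C :=
  Otheta d a i * u i + (if i is j.+1 then u j else 0).
Definition fY (d : nat) (a b c : C) (u : nat -> C) (i : nat) : C :=
  Otheta d b i * u i + Ophi d a b c i.+1 * u i.+1.
Definition fZ (d : nat) (a b c : C) (u : nat -> C) (i : nat) : C :=
  fX d a (fY d a b c u) i + fY d a b c (fX d a u) i
  - (2%:R * a * b - c * d.+1%:R) * u i.
Definition vecn (d : nat) (u : nat -> C) : 'cV[C]_d.+1 := \col_i u i.

(** For even [d] the index [d + 1] is odd, and the factor [i - d - 1] vanishes there. So [Y] does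
    not see coordinates beyond [d], and identities on unbounded sequences descend to matrices. *)
Lemma Ophi_last d a b c : ~~ odd d -> Ophi d a b c d.+1 = 0.
Proof. by move=> d_even; rewrite /Ophi /= d_even; field. Qed.

Lemma vecnE d (w : 'cV[C]_d.+1) : w = vecn d (fun i => w (inord i) 0).
Proof. by apply/colP => i; rewrite !mxE inord_val. Qed.

Lemma OX_vecn d a u : OX d a *m vecn d u = vecn d (fX d a u).
Proof.
apply/colP => i; rewrite !mxE (bigD1 i) //= !mxE eqxx /fX; congr (_ + _).
case: i => -[|i] lt_i /=.
  by rewrite big1 // => j /negPf ji; rewrite !mxE eq_sym ji mul0r.
have lt_i' : (i < d.+1)%N by apply: ltnW.
rewrite (bigD1 (Ordinal lt_i')) /=; last by rewrite -val_eqE /= ltn_eqF.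
rewrite !mxE -val_eqE /= gtn_eqF // eqxx mul1r big1 ?addr0 // => j /andP[/negPf ji ij].
by rewrite !mxE eq_sym ji /= eqSS eq_sym (negPf ij : (j == i :> nat) = _) mul0r.
Qed.

Lemma OY_vecn d a b c u : ~~ odd d ->
  OY d a b c *m vecn d u = vecn d (fY d a b c u).
Proof.
move=> d_even; apply/colP => i; rewrite !mxE (bigD1 i) //= !mxE eqxx /fY.
congr (_ + _); case: (ltnP i d) => [lt_i|ge_i].
  have lt_i' : (i.+1 < d.+1)%N by [].
  rewrite (bigD1 (Ordinal lt_i')) /=; last by rewrite -val_eqE /= gtn_eqF.
  rewrite !mxE -val_eqE /= ltn_eqF // eqxx big1 ?addr0 // => j /andP[/negPf ji /negPf ij].
  by rewrite !mxE eq_sym ji /= (ij : (j == i.+1 :> nat) = _) mul0r.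
have -> : (i : nat) = d by apply/eqP; rewrite eqn_leq ge_i -ltnS ltn_ord.
rewrite Ophi_last // mul0r big1 // => j /negPf ji; rewrite !mxE eq_sym ji.
case: eqP => [ji'|_]; last by rewrite mul0r.
by have := ltn_ord j; rewrite ji' ltnS ltnNge ge_i.
Qed.

Lemma Omod_vecn d a b c g u : ~~ odd d ->
  Omod d a b c g *m vecn d u =
  vecn d (match nat_of_ord g with
          | 0 => fX d a u | 1 => fY d a b c u | _ => fZ d a b c u end).
Proof.
move=> de; case: g => -[|[|g]] lt_g; rewrite /Omod /= ?OX_vecn ?OY_vecn //.
rewrite mulmxBl mulmxDl -!mulmxA OY_vecn // !OX_vecn OY_vecn // mul_scalar_mx.
by apply/colP => i; rewrite !mxE.
Qed.

Lemma mx_vecn_inj d m (A B : 'M[C]_(m, d.+1)) :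
  (forall u, A *m vecn d u = B *m vecn d u) -> A = B.
Proof.
move=> AB; apply/row_matrixP => i; apply/rowP => j.
have := AB (fun l => (l == j)%:R) => /colP/(_ i).
rewrite !mxE (bigD1 j) //= (bigD1 (F := fun l => B i l * _) j) //=.
by rewrite !mxE eqxx !mulr1 !big1 ?addr0 // => l /negPf lj;
   rewrite mxE (lj : (l == j :> nat) = _) mulr0.
Qed.

Lemma signE i : (-1) ^+ i = (if odd i then -1 else 1) :> C.
Proof. by rewrite -signr_odd; case: (odd i); rewrite ?expr0 ?expr1. Qed.

(** On unbounded sequences the relations are formal identities in [a], [b], [c], [d]. Small indices
    are treated apart because predecessor terms are missing there. *)
Lemma fZX d a b c u i :
  fZ d a b c (fX d a u) i + fX d a (fZ d a b c u) i
  = fY d a b c u i + (2%:R * c * a - b * d.+1%:R) * u i.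
Proof.
case: i => [|[|i]]; rewrite /fZ /fX /fY /Otheta /Ophi ?signE /=; try by field.
by case: (odd i) => /=; field.
Qed.

Lemma fYZ d a b c u i :
  fY d a b c (fZ d a b c u) i + fZ d a b c (fY d a b c u) i
  = fX d a u i + (2%:R * b * c - a * d.+1%:R) * u i.
Proof.
case: i => [|[|i]]; rewrite /fZ /fX /fY /Otheta /Ophi ?signE /=; try by field.
by case: (odd i) => /=; field.
Qed.

(** * Homomorphisms out of O_d *)

Lemma I3_ind (Q : 'I_3 -> Prop) : Q 0 -> Q 1 -> Q 2%:R -> forall g, Q g.
Proof.
move=> Q0 Q1 Q2 [[|[|[|//]]] lt_g].
- by rewrite (_ : Ordinal _ = 0) //; apply: val_inj.
- by rewrite (_ : Ordinal _ = 1) //; apply: val_inj.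
- by rewrite (_ : Ordinal _ = 2%:R) //; apply: val_inj.
Qed.

Lemma Omod_relZ d a b c :
  Omod d a b c 0 *m Omod d a b c 1 + Omod d a b c 1 *m Omod d a b c 0
  - Omod d a b c 2%:R = (2%:R * a * b - c * d.+1%:R)%:M.
Proof. by rewrite /Omod /= opprB addrC subrK. Qed.

Lemma Omod_relY d a b c : ~~ odd d ->
  Omod d a b c 2%:R *m Omod d a b c 0 + Omod d a b c 0 *m Omod d a b c 2%:R
  - Omod d a b c 1 = (2%:R * c * a - b * d.+1%:R)%:M.
Proof.
move=> de; apply: mx_vecn_inj => u.
rewrite mulmxBl mulmxDl -!mulmxA !Omod_vecn // mul_scalar_mx /=.
by apply/colP => i; rewrite !mxE fZX; ring.
Qed.

Lemma Omod_relX d a b c : ~~ odd d ->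
  Omod d a b c 1 *m Omod d a b c 2%:R + Omod d a b c 2%:R *m Omod d a b c 1
  - Omod d a b c 0 = (2%:R * b * c - a * d.+1%:R)%:M.
Proof.
move=> de; apply: mx_vecn_inj => u.
rewrite mulmxBl mulmxDl -!mulmxA !Omod_vecn // mul_scalar_mx /=.
by apply/colP => i; rewrite !mxE fYZ; ring.
Qed.

Section Chain.
Variables (m d : nat) (a : C) (A0 : 'M[C]_m) (v : 'cV[C]_m).

Fixpoint chain (i : nat) : 'cV[C]_m :=
  if i is j.+1 then A0 *m chain j - Otheta d a j *: chain j else v.

Lemma mulmx_chain i : A0 *m chain i = chain i.+1 + Otheta d a i *: chain i.
Proof. by rewrite /= subrK. Qed.

End Chain.

(* The relation [{X,{X,Y}} = Y + kappa_Y + 2 kappa_Z X] determines [Y] on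
   [chain (i+2)] from its values on [chain i] and [chain (i+1)]. *)
Lemma chain_raise m d a b c (A0 A1 A2 : 'M[C]_m) v :
  A0 *m A1 + A1 *m A0 - A2 = (2%:R * a * b - c * d.+1%:R)%:M ->
  A2 *m A0 + A0 *m A2 - A1 = (2%:R * c * a - b * d.+1%:R)%:M ->
  A1 *m v = Otheta d b 0 *: v ->
  A1 *m chain d a A0 v 1 =
    Otheta d b 1 *: chain d a A0 v 1 + Ophi d a b c 1 *: v ->
  forall i, A1 *m chain d a A0 v i.+1 =
    Otheta d b i.+1 *: chain d a A0 v i.+1 + Ophi d a b c i.+1 *: chain d a A0 v i.
Proof.
move=> relZ relY A1v A1v1.
have cubic (u : 'cV_m) : A0 *m (A0 *m (A1 *m u)) + A0 *m (A1 *m (A0 *m u))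
    + A0 *m (A1 *m (A0 *m u)) + A1 *m (A0 *m (A0 *m u)) = A1 *m u + (2%:R * c * a - b * d.+1%:R) *: u
    + (2%:R * (2%:R * a * b - c * d.+1%:R)) *: (A0 *m u).
  have eqA2 : A2 = A0 *m A1 + A1 *m A0 - (2%:R * a * b - c * d.+1%:R)%:M.
    by rewrite -relZ opprB addrC subrK.
  move/(congr1 (mulmx^~ u)): relY.
  rewrite eqA2 mul_scalar_mx !(mulmxBl, mulmxDl, mulmxBr, mulmxDr) -!mulmxA.
  rewrite !mulNmx mulmxN !mul_scalar_mx -!scalemxAr.
  move: (A0 *m (A0 *m (A1 *m u))) => w1; move: (A0 *m (A1 *m (A0 *m u))) => w2.
  move: (A1 *m (A0 *m (A0 *m u))) (A1 *m u) (A0 *m u) => w3 w4 w5.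
  move=> E; apply/colP => r; move: E => /colP/(_ r); rewrite !mxE => /eqP.
  rewrite -subr_eq0 => /eqP E; apply/eqP; rewrite -subr_eq0; apply/eqP.
  by rewrite -[RHS]E; ring.
set x := chain d a A0 v in A1v1 *; have x0 : x 0 = v by [].
rewrite -x0 in A1v A1v1.
have A0x i : A0 *m x i = x i.+1 + Otheta d a i *: x i by apply: mulmx_chain.
clearbody x.
pose p i := if i is j.+1 then Ophi d a b c i *: x j else 0.
(* Since [theta_(i-1) + theta_i = (-1)^i], the eigenvalue attached to [x (i-1)] is written without a
   predecessor; [i = 0] is included because [p 0] and [phi_0] vanish. *)
have A0p i : A0 *m p i = Ophi d a b c i *: x i + ((-1) ^+ i - Otheta d a i) *: p i.
  case: i => [|i] /=; first by rewrite mulmx0 scaler0 addr0 /Ophi /= !mul0r scale0r.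
  rewrite -scalemxAr A0x scalerDr !scalerA; congr (_ + _ *: _).
  by rewrite mulrC; congr (_ * _); rewrite /Otheta exprS; field.
suff two i : A1 *m x i = Otheta d b i *: x i + p i /\
    A1 *m x i.+1 = Otheta d b i.+1 *: x i.+1 + p i.+1 by move=> i; case: (two i).
elim: i => [|i [IH0 IH1]]; first by rewrite addr0 A1v.
(* In the cubic relation at [x i] the unknown [A1 *m x i.+2] comes only from
   [A1 *m (A0 *m (A0 *m x i))], with coefficient 1; the induction hypotheses give all other
   terms. *)
split=> //=; rewrite /= in IH1; have := cubic (x i).
rewrite !(A0x, A0p, IH0, IH1, mulmxDr, =^~ scalemxAr).
move: (A1 *m x i.+2) => w1; move: (x i) (x i.+1) (x i.+2) (p i) => w2 w3 w4 w5.
have entD (u w : 'cV[C]_m) r : (u + w) r 0 = u r 0 + w r 0 by rewrite mxE.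
have entZ z (u : 'cV[C]_m) r : (z *: u) r 0 = z * u r 0 by rewrite mxE.
move=> E; apply/colP => r; move: E => /colP/(_ r).
repeat first [rewrite -> entD | rewrite -> entZ]; move=> /eqP.
rewrite -subr_eq0 => /eqP E; apply/eqP; rewrite -subr_eq0; apply/eqP.
rewrite -[RHS]E /Otheta /Ophi /= !signE /=.
by case: (odd i) => /=; field.
Qed.

(** The only candidate for a homomorphism from O_d with [v_0] sent to [v]: in O_d, [v_(i+1)] is
    [(X - theta_i) v_i]. *)
Definition chain_mx (m d : nat) (a : C) (A0 : 'M[C]_m) (v : 'cV[C]_m) :
  'M[C]_(m, d.+1) := \matrix_(r, i) chain d a A0 v i r 0.

Lemma chain_mx_vecn m d a (A0 : 'M_m) v u :
  chain_mx d a A0 v *m vecn d u = \sum_(i < d.+1) u i *: chain d a A0 v i.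
Proof.
apply/colP => r; rewrite mxE summxE; apply: eq_bigr => i _.
by rewrite !mxE mulrC.
Qed.

(** Compatibility with X holds by construction, the vanishing of the vector of index [d + 1] closing
    the chain. For Y it is [chain_raise], and Z is a polynomial in X and Y on both sides. *)
Lemma Omod_hom m d a b c (A : 'I_3 -> 'M[C]_m) v :
  ~~ odd d ->
  A 0 *m A 1 + A 1 *m A 0 - A 2%:R = (2%:R * a * b - c * d.+1%:R)%:M ->
  A 2%:R *m A 0 + A 0 *m A 2%:R - A 1 = (2%:R * c * a - b * d.+1%:R)%:M ->
  A 1 *m v = Otheta d b 0 *: v ->
  A 1 *m chain d a (A 0) v 1 =
    Otheta d b 1 *: chain d a (A 0) v 1 + Ophi d a b c 1 *: v ->
  chain d a (A 0) v d.+1 = 0 ->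
  forall g, chain_mx d a (A 0) v *m Omod d a b c g = A g *m chain_mx d a (A 0) v.
Proof.
move=> de relZ relY A1v A1v1 xd; have raise := chain_raise relZ relY A1v A1v1.
set S := chain_mx _ _ _ _.
have hX : S *m Omod d a b c 0 = A 0 *m S.
  apply: mx_vecn_inj => u; rewrite -!mulmxA Omod_vecn // !chain_mx_vecn /=.
  rewrite mulmx_sumr /fX.
  under [RHS]eq_bigr do rewrite -scalemxAr mulmx_chain scalerDr.
  under eq_bigr do rewrite scalerDl.
  rewrite !big_split /= addrC; congr (_ + _); last first.
    by apply: eq_bigr => i _; rewrite scalerA mulrC.
  by rewrite big_ord_recl scale0r add0r [RHS]big_ord_recr /= -/(chain d a (A 0) v d.+1) xd scaler0 addr0.
have hY : S *m Omod d a b c 1 = A 1 *m S.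
  apply: mx_vecn_inj => u; rewrite -!mulmxA Omod_vecn // !chain_mx_vecn /=.
  rewrite mulmx_sumr /fY.
  under eq_bigr do rewrite scalerDl.
  rewrite big_split /= [X in X + _ = _]big_ord_recl [X in _ + X = _]big_ord_recr [RHS]big_ord_recl /=.
  rewrite Ophi_last // mul0r scale0r addr0 -scalemxAr A1v scalerA mulrC -addrA.
  congr (_ + _); rewrite -big_split /=; apply: eq_bigr => i _.
  by rewrite -scalemxAr [A 1 *m _]raise [RHS]scalerDr !scalerA ![u _ * _]mulrC.
apply: I3_ind => //.
have -> : A 2%:R = A 0 *m A 1 + A 1 *m A 0 - (2%:R * a * b - c * d.+1%:R)%:M.
  by rewrite -relZ opprB addrC subrK.
have -> : Omod d a b c 2%:R = Omod d a b c 0 *m Omod d a b c 1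
    + Omod d a b c 1 *m Omod d a b c 0 - (2%:R * a * b - c * d.+1%:R)%:M by [].
rewrite mulmxBr mulmxDr mulmxBl mulmxDl !mulmxA hX hY -!mulmxA hX hY.
by rewrite mul_scalar_mx mul_mx_scalar.
Qed.

Lemma chain_horner m d a (A0 : 'M[C]_m.+1) v i :
  chain d a A0 v i =
  horner_mx A0 (\prod_(h < i) ('X - (Otheta d a h)%:P)) *m v.
Proof.
elim: i => [|i IHi] /=; first by rewrite big_ord0 rmorph1 mul1mx.
rewrite big_ord_recr /= mulrC rmorphM -mulmxA -IHi rmorphB /= horner_mx_X.
by rewrite horner_mx_C mulmxBl mul_scalar_mx.
Qed.

Lemma chain_last d a (A0 : 'M[C]_d.+1) v :
  char_poly A0 = \prod_(h < d.+1) ('X - (Otheta d a h)%:P) ->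
  chain d a A0 v d.+1 = 0.
Proof. by move=> chA0; rewrite chain_horner -chA0 Cayley_Hamilton mul0mx. Qed.

(** For even [d], the indices [i] and [d - i] have the same parity. Reversing the order thus
    identifies the spectrum of [X] in O_d(-a,b,c) with that of [-X] in O_d(a,b,c). *)
Lemma OthetaN d a i : ~~ odd d -> (i <= d)%N ->
  Otheta d (- a) (d - i) = - Otheta d a i.
Proof.
move=> de id; rewrite /Otheta !signE oddB // (negPf de) natrB //=.
by case: (odd i); field.
Qed.

Lemma prod_OthetaN d a : ~~ odd d ->
  \prod_(h < d.+1) ('X - (Otheta d (- a) h)%:P) =
  \prod_(h < d.+1) ('X - (- Otheta d a h)%:P).
Proof.
move=> de; rewrite (reindex_inj rev_ord_inj) /=; apply: eq_bigr => h _.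
by rewrite subSS OthetaN // -ltnS.
Qed.

Lemma char_poly_trmx (R : comNzRingType) m (M : 'M[R]_m) : char_poly M^T = char_poly M.
Proof.
rewrite /char_poly -det_tr; congr (\det _); apply/matrixP => i j.
by rewrite !mxE eq_sym.
Qed.

Lemma char_OX d a s :
  char_poly (s *: OX d a) = \prod_(h < d.+1) ('X - (s * Otheta d a h)%:P).
Proof.
rewrite char_poly_trig; first by apply: eq_bigr => h _; rewrite !mxE eqxx.
apply/is_trig_mxP => i j ij; rewrite !mxE -val_eqE /= ltn_eqF // ltn_eqF ?mulr0 //.
exact: leqW.
Qed.

Lemma char_OY d a b c s :
  char_poly (s *: OY d a b c) = \prod_(h < d.+1) ('X - (s * Otheta d b h)%:P).
Proof.
rewrite -char_poly_trmx char_poly_trig; first by apply: eq_bigr => h _; rewrite !mxE eqxx.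
apply/is_trig_mxP => i j ij; rewrite !mxE -val_eqE /= gtn_eqF // ltn_eqF ?mulr0 //.
exact: leqW.
Qed.

Lemma char_OXN d a : ~~ odd d ->
  char_poly (-1 *: OX d a) = \prod_(h < d.+1) ('X - (Otheta d (- a) h)%:P).
Proof.
move=> de; apply: etrans (char_OX d a (-1)) _.
apply: etrans (esym (prod_OthetaN a de)).
by apply: eq_bigr => h _; rewrite mulN1r.
Qed.

Lemma char_OYN d a b c : ~~ odd d ->
  char_poly (-1 *: OY d a b c) = \prod_(h < d.+1) ('X - (Otheta d (- b) h)%:P).
Proof.
move=> de; apply: etrans (char_OY d a b c (-1)) _.
apply: etrans (esym (prod_OthetaN b de)).
by apply: eq_bigr => h _; rewrite mulN1r.
Qed.

(** * Irreducibility *)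

Definition sub_closed m (A : 'I_3 -> 'M[C]_m) (Q : 'cV[C]_m -> Prop) : Prop :=
  [/\ Q 0, forall (a : C) u v, Q u -> Q v -> Q (a *: u + v) &
      forall g u, Q u -> Q (A g *m u)].

Definition has_eig m (A0 : 'M[C]_m) (Q : 'cV[C]_m -> Prop) (t : C) : Prop :=
  exists w, [/\ Q w, w != 0 & A0 *m w = t *: w].

Definition gX (d : nat) (a t : C) (u : nat -> C) (i : nat) : C := fX d a u i - t * u i.

Lemma eq_gX d a t u v : u =1 v -> gX d a t u =1 gX d a t v.
Proof. by move=> uv [|i]; rewrite /gX /fX !uv. Qed.

Lemma gXC d a s t u : gX d a s (gX d a t u) =1 gX d a t (gX d a s u).
Proof. by move=> [|[|i]]; rewrite /gX /fX; ring. Qed.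

Lemma vecn_gX d a t u : vecn d (gX d a t u) = OX d a *m vecn d u - t *: vecn d u.
Proof. by rewrite OX_vecn; apply/colP => i; rewrite !mxE. Qed.

(** By lower bidiagonality, coordinate [k] of [X u] is [theta_k] times [u k] when everything before
    [k] is zero, so subtracting [theta_k] removes it. *)
Lemma gX_low d a u k : (forall i, (i < k)%N -> u i = 0) ->
  forall i, (i < k.+1)%N -> gX d a (Otheta d a k) u i = 0.
Proof.
move=> uk i; rewrite ltnS leq_eqVlt /gX /fX => /orP[/eqP->|ik].
  rewrite addrAC subrr add0r; case: k {i} uk => // k uk.
  by rewrite uk.
rewrite (uk i) // !mulr0 subr0 add0r; case: i ik => // i ik.
by rewrite uk // ltnW.
Qed.

Fixpoint gXs (d : nat) (a : C) (j : nat) (u : nat -> C) (m : nat) : nat -> C :=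
  if m is m'.+1 then gX d a (Otheta d a (j + m')) (gXs d a j u m') else u.

Lemma gXs_low d a j u m : (forall i, (i < j)%N -> u i = 0) ->
  forall i, (i < j + m)%N -> gXs d a j u m i = 0.
Proof.
move=> uj; elim: m => [|m IHm]; first by rewrite addn0.
by rewrite addnS; apply: gX_low.
Qed.

Lemma gX_gXs d a t j u m :
  gX d a t (gXs d a j u m) =1 gXs d a j (gX d a t u) m.
Proof. by elim: m => // m IHm i /=; rewrite gXC; apply: eq_gX. Qed.

Section Eigen.
Variables (d : nat) (a b c : C) (Q : 'cV[C]_d.+1 -> Prop).
Hypothesis d_even : ~~ odd d.
Hypothesis Qsub : sub_closed (Omod d a b c) Q.
Hypothesis phi_neq0 : forall i, (0 < i <= d)%N -> Ophi d a b c i != 0.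
Hypothesis theta_inj : forall i j, (i <= d)%N -> (j <= d)%N ->
  Otheta d a i = Otheta d a j -> i = j.

Let Qlin : forall (x : C) u v, Q u -> Q v -> Q (x *: u + v).
Proof. by case: Qsub. Qed.
Let QX u : Q u -> Q (OX d a *m u).
Proof. by case: Qsub => _ _ /(_ 0 u). Qed.
Let QY u : Q u -> Q (OY d a b c *m u).
Proof. by case: Qsub => _ _ /(_ 1 u). Qed.

Let Q_gX t u : Q (vecn d u) -> Q (vecn d (gX d a t u)).
Proof. by move=> Qu; rewrite vecn_gX addrC -scaleNr; apply: Qlin => //; apply: QX. Qed.

Let Q_gXs j u m : Q (vecn d u) -> Q (vecn d (gXs d a j u m)).
Proof. by move=> Qu; elim: m => // m IHm; apply: Q_gX. Qed.

Let vecn_eq0 u i : vecn d u = 0 -> (i <= d)%N -> u i = 0.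
Proof. by move=> /colP/(_ (inord i)) + id; rewrite !mxE inordK. Qed.

(** The factors [X - theta_0], [X - theta_1], ... applied in turn annihilate [w] after at most
    [d + 1] steps; the last nonzero vector on the way is an eigenvector. *)
Lemma eig_exists w : Q w -> w != 0 -> exists2 j, (j <= d)%N & has_eig (OX d a) Q (Otheta d a j).
Proof.
rewrite [w]vecnE; set u := fun _ => _ => Qu u_neq0.
have ex0 : exists m, vecn d (gXs d a 0 u m) == 0.
  exists d.+1; apply/eqP/colP => i; rewrite !mxE.
  by apply: gXs_low.
case: (ex_minnP ex0) => -[|m] /eqP um0 m_min; first by rewrite um0 eqxx in u_neq0.
have um_neq0 : vecn d (gXs d a 0 u m) != 0.
  by apply/negP => /m_min; rewrite ltnn.
exists m.
  rewrite -ltnS; apply: m_min; apply/eqP/colP => i; rewrite !mxE.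
  by apply: gXs_low.
exists (vecn d (gXs d a 0 u m)); split=> //; first exact: Q_gXs.
by apply/eqP; rewrite -subr_eq0 -vecn_gX um0.
Qed.

(** At an index [i] other than [j] the eigenvalue equation determines [u i] from its predecessor,
    because [theta_i] and [theta_j] differ. So zeros propagate up to [j], and past [j] as well if
    [u j] were zero. *)
Lemma eig_low w j : (j <= d)%N -> w != 0 -> OX d a *m w = Otheta d a j *: w ->
  exists u, [/\ w = vecn d u, forall i, (i < j)%N -> u i = 0 & u j != 0].
Proof.
move=> jd w_neq0; rewrite [w]vecnE; set u := fun _ => _ => Xu.
have gu i : (i <= d)%N -> gX d a (Otheta d a j) u i = 0.
  by apply: vecn_eq0; rewrite vecn_gX Xu subrr.
have u_step i : (i <= d)%N -> i != j -> (if i is k.+1 then u k else 0) = 0 -> u i = 0.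
  move=> id ij pred0; have := gu i id; rewrite /gX /fX pred0 addr0 -mulrBl.
  move/eqP; rewrite mulf_eq0 subr_eq0 => /orP[/eqP/theta_inj|/eqP//] ij'.
  by rewrite ij' ?eqxx in ij.
have ulow i : (i < j)%N -> u i = 0.
  elim: i => [|i IHi] ij; apply: u_step => //; try by rewrite ltn_eqF.
  - exact: leq_trans (ltnW ij) jd.
  - by apply: IHi; apply: ltnW.
exists u; split=> //; apply: contraNneq w_neq0 => uj0; rewrite [w]vecnE.
apply/eqP/colP => i; rewrite !mxE -/(u i).
have := ltn_ord i; rewrite ltnS; elim: {i}(i : nat) => [|i IHi] id.
  by case: (eqVneq 0%N j) => [->//|ij]; apply: u_step.
by case: (eqVneq i.+1 j) => [->//|ij]; apply: u_step => //; apply/IHi/ltnW.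
Qed.

(* [Y] moves a [theta_(j+1)]-eigenvector of [X] up to coordinate [j]; the
   factors [X - theta_i], [i > j], then leave a [theta_j]-eigenvector. *)
Lemma eig_down j : (j < d)%N -> has_eig (OX d a) Q (Otheta d a j.+1) ->
  has_eig (OX d a) Q (Otheta d a j).
Proof.
move=> jd [w [Qw w_neq0 Xw]]; have [u [wu ulow uj]] := eig_low jd w_neq0 Xw.
rewrite {w w_neq0 Xw}wu in Qw.
set y := fY d a b c u.
have Qy : Q (vecn d y) by rewrite -OY_vecn //; apply: QY.
have ylow i : (i < j)%N -> y i = 0.
  by move=> ij; rewrite /y /fY !ulow ?mulr0 ?addr0 // ltnS // ltnW.
have yj : y j != 0 by rewrite /y /fY ulow // mulr0 add0r mulf_neq0 // phi_neq0.
pose r m := gXs d a j.+1 y m.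
have rlow m i : (i < j)%N -> r m i = 0.
  elim: m i => [|m IHm] i ij; first exact: ylow.
  rewrite /r /= /gX /fX -/(r m) !IHm // !mulr0 subr0 add0r.
  by case: i ij => // i ij; rewrite IHm // ltnW.
(* Below [j] everything is zero, so each factor only multiplies coordinate [j] by some
   [theta_j - theta_i] with [i > j]. *)
have rj m : (j + m <= d)%N -> r m j != 0.
  elim: m => [|m IHm] jm //; rewrite /r /= /gX /fX -/(r m).
  rewrite (_ : (if j is _.+1 then _ else _) = 0); last first.
    by case: (j) rlow => // k rlow; rewrite rlow.
  rewrite addr0 -mulrBl mulf_neq0 ?IHm //; last by rewrite -ltnS -addnS ltnW.
  rewrite subr_eq0; apply/eqP => /theta_inj ejm.
  have : j = (j.+1 + m)%N by apply: ejm; lia.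
  lia.
exists (vecn d (r (d - j)%N)); split.
- exact: Q_gXs.
- apply: contraNneq (rj (d - j)%N _) => [r0|]; last by rewrite subnKC // ltnW.
  by apply/eqP; apply: vecn_eq0 r0 (ltnW jd).
(* The factors commute. With [X - theta_j] moved to the front, they clear the coordinates [j], ...,
   [d] one after the other. *)
- apply/eqP; rewrite -subr_eq0 -vecn_gX; apply/eqP/colP => i; rewrite !mxE.
  rewrite gX_gXs; apply: gXs_low; first exact: gX_low.
  by rewrite addSn subnKC // ltnW.
Qed.

(** Descending from [theta_d] puts into [Q] an eigenvector for every [theta_j]. Its first nonzero
    coordinate is the one at [j], so these vectors form a triangular basis. *)
Lemma eig_top_full : has_eig (OX d a) Q (Otheta d a d) -> forall w, Q w.
Proof.
move=> eig_d.
have eig j : (j <= d)%N -> has_eig (OX d a) Q (Otheta d a (d - j)).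
  elim: j => [|j IHj] jd; first by rewrite subn0.
  by apply: eig_down; [lia|rewrite -subSn //; apply/IHj/ltnW].
suff full m u : (m <= d.+1)%N -> (forall i, (i < d.+1 - m)%N -> u i = 0) -> Q (vecn d u).
  by move=> w; rewrite [w]vecnE; apply: (full d.+1) => // i; rewrite subnn.
elim: m u => [|m IHm] u md ulow.
  rewrite (_ : vecn d u = 0); first by case: Qsub.
  by apply/colP => i; rewrite !mxE ulow // subn0.
have [w [Qw w_neq0 Xw]] := eig m md.
have [x [wx xlow xj]] := eig_low (leq_subr m d) w_neq0 Xw.
set j := (d - m)%N in xlow xj.
have -> : vecn d u = (u j / x j) *: w + vecn d (fun i => u i - u j / x j * x i).
  by rewrite wx; apply/colP => i; rewrite !mxE; ring.
apply: Qlin => //; apply: IHm => [|i]; first exact: ltnW.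
rewrite subSn // ltnS -/j leq_eqVlt => /orP[/eqP->|ij]; first by rewrite divfK // subrr.
by rewrite (xlow i ij) (ulow i) ?mulr0 ?subr0 // subSS.
Qed.

End Eigen.

(** Each step raises the highest nonzero index by one and negates the leading coefficient. The chain
    from the first basis vector is therefore triangular with diagonal entries 1 and -1. *)
Lemma chain_e0 d a b i : 
  exists u, [/\ chain d b (-1 *: OX d a) (vecn d (fun l => (l == 0%N)%:R)) i = vecn d u,
    forall r, (i < r)%N -> u r = 0 & u i = (-1) ^+ i].
Proof.
elim: i => [|i [u [eq_u uhigh ui]]].
  by exists (fun l => (l == 0%N)%:R); split=> // -[].
exists (fun r => - fX d a u r - Otheta d b i * u r); split.
- by rewrite /= eq_u -scalemxAl OX_vecn; apply/colP => r; rewrite !mxE mulN1r.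
- move=> r ir; rewrite /fX uhigh ?(ltnW ir) // !mulr0 subr0 add0r.
  by case: r ir => // r ir; rewrite uhigh // oppr0.
- by rewrite /fX ui uhigh // !mulr0 subr0 add0r exprS mulN1r.
Qed.

Lemma anticomm_scale m (A B D : 'M[C]_m) (x s t r : C) :
  A *m B + B *m A - D = x%:M -> s * t = r ->
  (s *: A) *m (t *: B) + (t *: B) *m (s *: A) - r *: D = (r * x)%:M.
Proof.
move=> rel <-; rewrite -!scalemxAl -!scalemxAr !scalerA [t * s]mulrC.
by rewrite -scalerDr -scalerBr rel scale_scalar_mx.
Qed.

(* This twist reverses the order of the eigenvalues of [X]. *)
Lemma Omod_flip d a b c : ~~ odd d ->
  exists2 S : 'M[C]_d.+1, S \in unitmx &
    forall g, S *m Omod d (- a) b (- c) g = twist eps_m1p1 id (Omod d a b c) g *m S.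
Proof.
move=> de; set e0 := vecn d (fun l => (l == 0%N)%:R).
(* [v_0] goes to the first basis vector, an eigenvector of the upper bidiagonal [Y] with eigenvalue
   [theta*_0], while X acts as [-X]. *)
exists (chain_mx d (- a) (-1 *: OX d a) e0).
  rewrite unitmxE -det_tr det_trig.
    rewrite (eq_bigr (fun i : 'I_d.+1 => (-1) ^+ (i : nat))) => [|i _]; last first.
      by have [u [eq_u _ ui]] := chain_e0 d a (- a) i; rewrite !mxE eq_u mxE.
    by rewrite unitfE; apply/prodf_neq0 => i _; rewrite signr_eq0.
  apply/is_trig_mxP => i j ij.
  by have [u [eq_u uhigh _]] := chain_e0 d a (- a) i; rewrite !mxE eq_u mxE uhigh.
apply: (Omod_hom (A := twist eps_m1p1 id (Omod d a b c))) => //.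
- rewrite /twist (anticomm_scale (Omod_relZ d a b c)) /eps_m1p1 /= ?mulr1 //.
  by congr _%:M; ring.
- rewrite /twist (anticomm_scale (Omod_relY a b c de)) /eps_m1p1 /= ?mulN1r ?opprK //.
  by congr _%:M; ring.
- rewrite /twist /eps_m1p1 /= scale1r OY_vecn //; apply/colP => i; rewrite !mxE.
  by rewrite /fY; case: (i : nat) => [|j] /=; rewrite ?mulr0 ?addr0.
- rewrite /twist /eps_m1p1 /= scale1r -scalemxAl OX_vecn.
  set u := fun r => - fX d a (fun l => (l == 0%N)%:R) r - Otheta d (- a) 0 * (r == 0%N)%:R.
  rewrite (_ : _ *: _ - _ = vecn d u); last first.
    by apply/colP => i; rewrite !mxE mulN1r.
  rewrite OY_vecn //; apply/colP => i; rewrite !mxE /fY /u /fX /Otheta /Ophi /=.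
  by case: (i : nat) => [|[|j]] /=; field.
- by apply: chain_last; apply: char_OXN.
Qed.

Lemma Omod_irreducible d a b c : ~~ odd d ->
  (forall i, (0 < i <= d)%N -> Ophi d a b c i != 0) ->
  (forall i, (0 < i <= d)%N -> Ophi d (- a) b (- c) i != 0) ->
  (forall i j, (i <= d)%N -> (j <= d)%N -> Otheta d a i = Otheta d a j -> i = j) ->
  mx_irreducible (Omod d a b c).
Proof.
move=> de phi_n0 phi'_n0 th_inj; split=> // Q Q0 Qlin QA.
have [[w Qw w_n0]|noQ] := classic (exists2 w, Q w & w != 0); last first.
  by left=> u Qu; apply: NNPP => u0; apply: noQ; exists u => //; apply/eqP.
right; have Qsub : sub_closed (Omod d a b c) Q by [].
apply: (eig_top_full de Qsub) => //.
have [S S_unit SA] := Omod_flip a b c de.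
pose Q' u := Q (S *m u).
have Q'sub : sub_closed (Omod d (- a) b (- c)) Q'.
  split=> [|x u v Qu Qv|g u Qu]; rewrite /Q' ?mulmx0 //.
    by rewrite mulmxDr -scalemxAr; apply: Qlin.
  rewrite mulmxA SA -mulmxA /twist -scalemxAl -[_ *: _]addr0.
  by apply: Qlin => //; apply: QA.
have th'_inj i j : (i <= d)%N -> (j <= d)%N ->
    Otheta d (- a) i = Otheta d (- a) j -> i = j.
  move=> id jd; rewrite -(subKn id) -(subKn jd) !OthetaN ?leq_subr //.
  move=> /oppr_inj/th_inj; rewrite !subKn //.
  by move=> H; have := H (leq_subr _ _) (leq_subr _ _); lia.
have Q'w : Q' (invmx S *m w) by rewrite /Q' mulKVmx.
have w'_n0 : invmx S *m w != 0.
  by apply: contraNneq w_n0 => /(congr1 (mulmx S)); rewrite mulKVmx // mulmx0 => ->.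
have [j jd eig_j] := eig_exists Q'sub Q'w w'_n0.
(* Stepping down in the flipped module is stepping up in the original one: its [theta_0] is minus
   the original [theta_d]. From there [eig_top_full] descends through all eigenvalues. *)
have eig_0 : has_eig (OX d (- a)) Q' (Otheta d (- a) 0).
  elim: j jd eig_j => // j IHj jd /(eig_down de Q'sub phi'_n0 th'_inj jd).
  by apply/IHj/ltnW.
have [u [Q'u u_n0 Xu]] := eig_0.
exists (S *m u); split=> //.
  by apply: contraNneq u_n0 => /(congr1 (mulmx (invmx S))); rewrite mulKmx // mulmx0 => ->.
have := SA 0; rewrite /twist /eps_m1p1 /= => /(congr1 (mulmx^~ u)).
have := OthetaN a de (leqnn d); rewrite subnn => th0.
rewrite -mulmxA Xu -scalemxAr th0 -!mulmxA -scalemxAl.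
by rewrite scaleN1r scaleNr => /oppr_inj.
Qed.

(** * Twists and homomorphisms of irreducible modules *)

Lemma irreducible_twist m eps (s t : 'I_3 -> 'I_3) (A : 'I_3 -> 'M[C]_m) :
  cancel t s -> (forall g, eps g != 0) -> mx_irreducible A ->
  mx_irreducible (twist eps s A).
Proof.
move=> ts eps_n0 [m_gt0 irrA]; split=> // Q Q0 Qlin QA.
apply: irrA => // g u Qu; have := QA (t g) u Qu; rewrite /twist ts => Qg.
rewrite -[_ *m _]addr0 -[A g](scalerK (eps_n0 g)) -scalemxAl.
exact: Qlin.
Qed.

(** Schur's argument on the source: the kernel is a proper submodule, hence zero, and a square
    injective matrix is invertible. *)
Lemma irreducible_hom_src m (A B : 'I_3 -> 'M[C]_m) S :
  mx_irreducible A -> S != 0 -> (forall g, S *m A g = B g *m S) -> S \in unitmx.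
Proof.
move=> [_ irrA] S_n0 SA.
case: (irrA (fun u => S *m u = 0)) => [|x u v Su Sv|g u Su|kerS|kerS].
- by rewrite mulmx0.
- by rewrite mulmxDr -scalemxAr Su Sv scaler0 addr0.
- by rewrite mulmxA SA -mulmxA Su mulmx0.
- rewrite -unitmx_tr -row_free_unit -kermx_eq0; apply/eqP/row_matrixP => i.
  rewrite row0; apply: trmx_inj; rewrite trmx0; apply: kerS.
  by apply: trmx_inj; rewrite trmx_mul trmxK -row_mul mulmx_ker row0 trmx0.
- case/eqP: S_n0; apply/matrixP => i j.
  have /colP/(_ i) := kerS (delta_mx j 0).
  by rewrite -colE !mxE.
Qed.

(** Schur's argument on the target: the image is a nonzero submodule, hence everything. *)
Lemma irreducible_hom_tgt m (A B : 'I_3 -> 'M[C]_m) S :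
  mx_irreducible B -> S != 0 -> (forall g, S *m A g = B g *m S) -> S \in unitmx.
Proof.
move=> [_ irrB] S_n0 SA.
case: (irrB (fun u => exists w, u = S *m w)) => [|x _ _ [w ->] [w' ->]|g _ [w ->]|imS|imS].
- by exists 0; rewrite mulmx0.
- by exists (x *: w + w'); rewrite mulmxDr -scalemxAr.
- by exists (A g *m w); rewrite !mulmxA SA.
- case/eqP: S_n0; apply/matrixP => i j.
  have /colP/(_ i) := imS (S *m delta_mx j 0) (ex_intro _ _ erefl).
  by rewrite -colE !mxE.
- have colS (j : 'I_m) : exists w : 'cV[C]_m, delta_mx j 0 = S *m w by apply: imS.
  have [f Sf] := fin_all_exists colS.
  pose T := \matrix_(i, j) f j i 0.
  have ST : S *m T = 1%:M.
    apply/matrixP => i j; have /colP/(_ i) := Sf j; rewrite !mxE andbT => ->.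
    by apply: eq_bigr => l _; rewrite mxE.
  by case/mulmx1_unit: ST.
Qed.

Lemma irreducible_iso m (A B : 'I_3 -> 'M[C]_m) :
  mx_iso A B -> mx_irreducible A -> mx_irreducible B.
Proof.
move=> [S S_unit SA] [m_gt0 irrA]; split=> // Q Q0 Qlin QB.
case: (irrA (fun u => Q (S *m u))) => [|||Q'|Q'].
- by rewrite mulmx0.
- by move=> x u v; rewrite mulmxDr -scalemxAr; apply: Qlin.
- by move=> g u; rewrite mulmxA SA -mulmxA; apply: QB.
- left=> u Qu; rewrite -[u](mulKVmx S_unit) in Qu *.
  by rewrite (Q' _ Qu) mulmx0.
- by right=> u; rewrite -[u](mulKVmx S_unit).
Qed.

Lemma mx_iso_sym m (A B : 'I_3 -> 'M[C]_m) S : S \in unitmx ->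
  (forall g, S *m A g = B g *m S) -> mx_iso B A.
Proof.
move=> S_unit SA; exists (invmx S); first by rewrite unitmx_inv.
by move=> g; apply: (canLR (mulKmx S_unit)); rewrite mulmxA SA mulmxK.
Qed.

(* Normalised by [v0fun d = 1] so that no division by [Ophi] is needed and
   the vector never vanishes. *)
Definition v0fun (d : nat) (a b c : C) (i : nat) : C :=
  if odd i then 0 else \prod_(i./2 <= l < d./2) Ophi d a b c l.*2.+2.

(** * A product-form eigenvector of Z in O_d *)

Section ExtremalVector.
Variables (d : nat) (a b c : C).
Hypothesis d_even : ~~ odd d.

Lemma v0fun_odd i : odd i -> v0fun d a b c i = 0.
Proof. by rewrite /v0fun => ->. Qed.

Lemma v0fun_step i : odd i.+1 -> (i < d)%N ->
  Ophi d a b c i.+2 * v0fun d a b c i.+2 = v0fun d a b c i.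
Proof.
move=> /= i_even id; rewrite /v0fun /= negbK (negPf i_even) [RHS]big_ltn.
  by rewrite even_halfK.
by rewrite ltn_half_double even_halfK.
Qed.

Definition v0 := vecn d (v0fun d a b c).

Lemma v0_neq0 : v0 != 0.
Proof.
apply/eqP => /colP/(_ ord_max); rewrite !mxE /v0fun /= (negPf d_even).
by rewrite big_geq // => /eqP; rewrite oner_eq0.
Qed.

(** On even coordinates both sides are diagonal and [theta*_i - theta_i = b - a]; on odd ones the
    recursion [v0fun_step] equates the terms contributed by the two neighbours. *)
Lemma OY_v0 : OY d a b c *m v0 = OX d a *m v0 + (b - a) *: v0.
Proof.
rewrite OY_vecn // OX_vecn; apply/colP => -[i id]; rewrite !mxE /= /fY /fX.
have [i_odd|i_even] := boolP (odd i).
  case: i i_odd id => // i i_odd id; rewrite v0fun_odd // v0fun_step //.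
  by rewrite !mulr0 add0r addr0.
rewrite (@v0fun_odd i.+1) //= mulr0 addr0.
rewrite (_ : (if i is _.+1 then _ else _) = 0); last first.
  by case: i i_even id => // i; rewrite /= negbK => i_odd _; rewrite v0fun_odd.
by rewrite /Otheta signE (negPf i_even); field.
Qed.

(** This lets [v0] serve as the image of [v_0] in twists where Y acts through [Z]. *)
Lemma OZ_v0 : Omod d a b c 2%:R *m v0 = (c + d%:R / 2%:R) *: v0.
Proof.
rewrite Omod_vecn //; apply/colP => -[i id]; rewrite !mxE /=.
have [i_odd|i_even] := boolP (odd i).
  case: i i_odd id => // i i_odd id.
  have step : Ophi d a b c i.+2 * v0fun d a b c i.+2 = v0fun d a b c i.
    by apply: v0fun_step => //; move: d_even i_odd => /=; lia.
  rewrite /fZ /fX /fY /= (@v0fun_odd i.+1) // -!step.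
  rewrite /Otheta !signE /=; rewrite /= in i_odd; rewrite (negPf i_odd) /=.
  by field.
rewrite /fZ /fX /fY /= (@v0fun_odd i.+1) //.
case: i i_even id => [|i] i_even id.
  by rewrite /Otheta /Ophi /=; field.
rewrite (@v0fun_odd i) /=; last by rewrite /= negbK in i_even.
by rewrite /Otheta /Ophi !signE /=; rewrite /= negbK in i_even; rewrite i_even /=; field.
Qed.

End ExtremalVector.

(** * Twists of O_d that are again of the form O_d *)

(** The span of [v0] and [X v0] is stable under [Z]: the anticommutator of [Z] and [X] is [Y] plus a
    scalar, and [Y v0] lies in that span. This supplies the condition of [Omod_hom] on the second
    chain vector. *)
Lemma OZX_v0 d a b c (e := c + d%:R / 2%:R) (v := v0 d a b c) : ~~ odd d ->
  Omod d a b c 2%:R *m (OX d a *m v) =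
  (1 - e) *: (OX d a *m v) + (b - a + (2%:R * c * a - b * d.+1%:R)) *: v.
Proof.
move=> de; have /(congr1 (mulmx^~ v)) := Omod_relY a b c de.
rewrite mulmxBl mulmxDl -!mulmxA OZ_v0 // -scalemxAr mul_scalar_mx.
have -> : Omod d a b c 1 = OY d a b c by [].
have -> : Omod d a b c 0 = OX d a by [].
rewrite OY_v0 // -/v.
move: (Omod d a b c 2%:R *m (OX d a *m v)) (OX d a *m v) => w1 w2 E.
apply/colP => i; move/colP/(_ i): E; rewrite !mxE => /eqP.
rewrite -subr_eq0 => /eqP E; apply/eqP; rewrite -subr_eq0; apply/eqP.
by rewrite -[RHS]E /e; ring.
Qed.

Lemma OZY_v0 d a b c (e := c + d%:R / 2%:R) (v := v0 d a b c) : ~~ odd d ->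
  Omod d a b c 2%:R *m (OY d a b c *m v) =
  (1 - e) *: (OY d a b c *m v) + (a - b + (2%:R * b * c - a * d.+1%:R)) *: v.
Proof.
move=> de; have /(congr1 (mulmx^~ v)) := Omod_relX a b c de.
rewrite mulmxBl mulmxDl -!mulmxA OZ_v0 // -scalemxAr mul_scalar_mx.
have -> : Omod d a b c 1 = OY d a b c by [].
have -> : Omod d a b c 0 = OX d a by [].
have := OY_v0 a b c de; rewrite -/v.
move: (Omod d a b c 2%:R *m (OY d a b c *m v)) (OX d a *m v) (OY d a b c *m v) => w1 w2 w3 E' E.
apply/colP => i; move/colP/(_ i): E; move/colP/(_ i): E'; rewrite !mxE => -> /eqP.
rewrite -subr_eq0 => /eqP E; apply/eqP; rewrite -subr_eq0; apply/eqP.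
by rewrite -[RHS]E /e; ring.
Qed.

Lemma chain_mx_neq0 m d a (A0 : 'M_m) v : v != 0 -> chain_mx d a A0 v != 0.
Proof.
apply: contraNneq => S0; apply/eqP/colP => r.
by have /matrixP/(_ r 0) := S0; rewrite !mxE.
Qed.

(** In the twist Y acts as [-Z], so [v_0] may go to [v0], whose eigenvalue dictates the parameter
    [-c]. The first parameter is the one with the right spectrum of X, and the permuted relations
    fix the third. Only a nonzero map is claimed; invertibility comes later from irreducibility. *)
Lemma Omod_hom_p1m1_s23 d a b c : ~~ odd d ->
  exists2 S : 'M[C]_d.+1, S != 0 & forall g,
    S *m Omod d a (- c) (- b) g = twist eps_p1m1 s23 (Omod d a b c) g *m S.
Proof.
move=> de; pose A := twist eps_p1m1 s23 (Omod d a b c).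
exists (chain_mx d a (A 0) (v0 d a b c)); first exact/chain_mx_neq0/v0_neq0.
apply: (Omod_hom (A := A)) => //.
- rewrite /A /twist [X in X - _]addrC.
  rewrite (anticomm_scale (Omod_relY a b c de)) /eps_p1m1 /= ?mulr1 ?mul1r //.
  by congr _%:M; ring.
- rewrite /A /twist [X in X - _]addrC.
  rewrite (anticomm_scale (Omod_relZ d a b c)) /eps_p1m1 /= ?mulr1 ?mul1r //.
  by congr _%:M; ring.
- rewrite /A /twist /eps_p1m1 /= -scalemxAl OZ_v0 // scalerA; congr (_ *: _).
  by rewrite /Otheta; field.
- rewrite /A /twist /eps_p1m1 /= scale1r -scalemxAl mulmxBr -scalemxAr OZ_v0 // OZX_v0 //.
  move: (OX d a *m v0 d a b c) (v0 d a b c) => x v; apply/colP => i; rewrite !mxE.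
  by rewrite /Otheta /Ophi /=; field.
- apply: chain_last; rewrite /A /twist /eps_p1m1 /= char_OX.
  by apply: eq_bigr => h _; rewrite mul1r.
Qed.

Lemma Omod_hom_m1p1_s23 d a b c : ~~ odd d ->
  exists2 S : 'M[C]_d.+1, S != 0 & forall g,
    S *m Omod d (- a) (- c) b g = twist eps_m1p1 s23 (Omod d a b c) g *m S.
Proof.
move=> de; pose A := twist eps_m1p1 s23 (Omod d a b c).
exists (chain_mx d (- a) (A 0) (v0 d a b c)); first exact/chain_mx_neq0/v0_neq0.
apply: (Omod_hom (A := A)) => //.
- rewrite /A /twist [X in X - _]addrC.
  rewrite (anticomm_scale (Omod_relY a b c de)) /eps_m1p1 /= ?mulrNN ?mulr1 //.
  by congr _%:M; ring.
- rewrite /A /twist [X in X - _]addrC.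
  rewrite (anticomm_scale (Omod_relZ d a b c)) /eps_m1p1 /= ?mulr1 ?mul1r //.
  by congr _%:M; ring.
- rewrite /A /twist /eps_m1p1 /= -scalemxAl OZ_v0 // scalerA; congr (_ *: _).
  by rewrite /Otheta; field.
- rewrite /A /twist /eps_m1p1 /= -!scalemxAl mulmxBr -!scalemxAr OZ_v0 // OZX_v0 //.
  move: (OX d a *m v0 d a b c) (v0 d a b c) => x v; apply/colP => i; rewrite !mxE.
  by rewrite /Otheta /Ophi /=; field.
- by apply: chain_last; apply: char_OXN.
Qed.

(** Here X acts as [-Y], whose characteristic polynomial is the one belonging to [-b]; the chain
    starts again at [v0]. *)
Lemma Omod_hom_p1m1_s123 d a b c : ~~ odd d ->
  exists2 S : 'M[C]_d.+1, S != 0 & forall g,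
    S *m Omod d (- b) (- c) a g = twist eps_p1m1 s123 (Omod d a b c) g *m S.
Proof.
move=> de; pose A := twist eps_p1m1 s123 (Omod d a b c).
exists (chain_mx d (- b) (A 0) (v0 d a b c)); first exact/chain_mx_neq0/v0_neq0.
apply: (Omod_hom (A := A)) => //.
- rewrite /A /twist.
  rewrite (anticomm_scale (Omod_relX a b c de)) /eps_p1m1 /= ?mulrNN ?mulr1 //.
  by congr _%:M; ring.
- rewrite /A /twist.
  rewrite (anticomm_scale (Omod_relZ d a b c)) /eps_p1m1 /= ?mulr1 ?mul1r //.
  by congr _%:M; ring.
- rewrite /A /twist /eps_p1m1 /= -scalemxAl OZ_v0 // scalerA; congr (_ *: _).
  by rewrite /Otheta; field.
- rewrite /A /twist /eps_p1m1 /= -!scalemxAl mulmxBr -!scalemxAr OZ_v0 // OZY_v0 //.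
  move: (OY d a b c *m v0 d a b c) (v0 d a b c) => x v; apply/colP => i; rewrite !mxE.
  by rewrite /Otheta /Ophi /=; field.
- by apply: chain_last; apply: char_OYN.
Qed.

(** * Coefficients of polynomials and Dunkl operators *)

Lemma refl_mpolyX (i : 'I_3) m : refl i 'X_[m] = ((-1) ^+ m i : C) *: 'X_[m].
Proof.
rewrite /refl comp_mpolyX [in RHS]mpolyXE_id (bigD1 i) //= [in RHS](bigD1 i) //=.
rewrite tnth_mktuple eqxx [(- 'X_i) ^+ _]exprNn -mul_mpolyC [RHS]mulrA; congr (_ * _ * _).
  by rewrite rmorphXn rmorphN rmorph1.
by apply: eq_bigr => j /negPf ji; rewrite tnth_mktuple ji.
Qed.

Lemma mcoeff_refl (i : 'I_3) p m : (refl i p)@_m = (-1) ^+ m i * p@_m.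
Proof.
rewrite /refl comp_mpolyEX [in RHS](mpolyE p) !raddf_sum /= mulr_sumr.
apply: eq_bigr => m' _; rewrite -/(refl i _) refl_mpolyX !mcoeffZ.
rewrite mcoeffX mulrCA; case: eqP => [->//|_]; by rewrite !mulr0.
Qed.

Lemma mcoeff_divX (i : 'I_3) p m : (divX i p)@_m = p@_(m + U_(i)).
Proof.
rewrite [in RHS](mpolyE p) /divX !raddf_sum /= [RHS](bigID (fun m' : 'X_{1..3} => (0 < m' i)%N)) /=.
rewrite [X in _ = _ + X]big1 ?addr0 => [|m']; last first.
  rewrite -leqNgt leqn0 mcoeffZ mcoeffX => /eqP m'i.
  case: eqP => [m'E|_]; last by rewrite mulr0.
  by move: m'i; rewrite m'E mnmDE mnm1E eqxx addn1.
apply: eq_bigr => m' m'i; rewrite !mcoeffZ !mcoeffX; congr (_ * (nat_of_bool _)%:R).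
have le_m' : (U_(i) <= m')%MM by rewrite lep1mP -lt0n.
by rewrite -(eqm_add2r U_(i)) submK.
Qed.

(* [T_i x_i^j = bra k i j x_i^(j-1)]. *)
Definition bra (k : 'I_3 -> RR) (i : 'I_3) (j : nat) : C :=
  j%:R + rC (k i) * (1 - (-1) ^+ j).

Lemma mcoeff_dunkl k (i : 'I_3) p m :
  (dunkl k i p)@_m = bra k i (m i).+1 * p@_(m + U_(i)).
Proof.
rewrite /dunkl mcoeffD mcoeffZ mcoeff_divX mcoeffB mcoeff_refl mcoeff_mderiv.
rewrite mnmDE mnm1E eqxx addn1 /bra exprS -mulr_natl; ring.
Qed.

Lemma mcoeffXiM (i : 'I_3) (p : P) m :
  ('X_i * p)@_m = if m i is 0 then 0 else p@_(m - U_(i)).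
Proof.
case mi: (m i) => [|j].
  apply/eqP; rewrite mcoeff_eq0 mulrC (perm_mem (msuppMX _ _)).
  apply/mapP => -[m' _ mE]; move: mi.
  by rewrite mE mnmDE mnm1E eqxx.
have le_m : (U_(i) <= m)%MM by rewrite lep1mP mi.
by rewrite -{1}(submK le_m) addmC mulrC mcoeffMX.
Qed.

(** The middle exponent belongs to x_2, the variable of extension; [a] and [b] are the exponents in
    the plane x_2 = 0. *)
Definition mm (a c b : nat) : 'X_{1..3} := [multinom nth 0%N [:: a; c; b] i | i < 3].
Definition cf (p : P) (a c b : nat) : C := p@_(mm a c b).

Lemma mmE (m : 'X_{1..3}) : m = mm (m 0) (m 1) (m 2%:R).
Proof. by apply/mnmP; apply: I3_ind; rewrite mnmE. Qed.

Lemma cfP p q : (forall a c b, cf p a c b = cf q a c b) -> p = q.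
Proof. by move=> pq; apply/mpolyP => m; rewrite (mmE m); apply: pq. Qed.

Lemma mdeg_mm a c b : mdeg (mm a c b) = (a + c + b)%N.
Proof. by rewrite mdegE !big_ord_recl big_ord0 !mnmE /= addn0 addnA. Qed.

Lemma mmD0 a c b : (mm a c b + U_(0%R))%MM = mm a.+1 c b.
Proof. by apply/mnmP; apply: I3_ind; rewrite !mnmE /= ?addn0 ?addn1. Qed.
Lemma mmD1 a c b : (mm a c b + U_(1%R))%MM = mm a c.+1 b.
Proof. by apply/mnmP; apply: I3_ind; rewrite !mnmE /= ?addn0 ?addn1. Qed.
Lemma mmD2 a c b : (mm a c b + U_(2%:R%R))%MM = mm a c b.+1.
Proof. by apply/mnmP; apply: I3_ind; rewrite !mnmE /= ?addn0 ?addn1. Qed.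

Lemma cfD p q a c b : cf (p + q) a c b = cf p a c b + cf q a c b.
Proof. exact: mcoeffD. Qed.
Lemma cfN p a c b : cf (- p) a c b = - cf p a c b.
Proof. exact: mcoeffN. Qed.
Lemma cfZ x p a c b : cf (x *: p) a c b = x * cf p a c b.
Proof. exact: mcoeffZ. Qed.

Lemma cf_refl0 p a c b : cf (refl 0 p) a c b = (-1) ^+ a * cf p a c b.
Proof. by rewrite /cf mcoeff_refl mnmE. Qed.
Lemma cf_refl1 p a c b : cf (refl 1 p) a c b = (-1) ^+ c * cf p a c b.
Proof. by rewrite /cf mcoeff_refl mnmE. Qed.
Lemma cf_refl2 p a c b : cf (refl 2%:R p) a c b = (-1) ^+ b * cf p a c b.
Proof. by rewrite /cf mcoeff_refl mnmE. Qed.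

Lemma cf_dunkl0 k p a c b : cf (dunkl k 0 p) a c b = bra k 0 a.+1 * cf p a.+1 c b.
Proof. by rewrite /cf mcoeff_dunkl mmD0 mnmE. Qed.
Lemma cf_dunkl1 k p a c b : cf (dunkl k 1 p) a c b = bra k 1 c.+1 * cf p a c.+1 b.
Proof. by rewrite /cf mcoeff_dunkl mmD1 mnmE. Qed.
Lemma cf_dunkl2 k p a c b :
  cf (dunkl k 2%:R p) a c b = bra k 2%:R b.+1 * cf p a c b.+1.
Proof. by rewrite /cf mcoeff_dunkl mmD2 mnmE. Qed.

Lemma cf_X0 p a c b : cf ('X_0 * p) a c b = if a is a'.+1 then cf p a' c b else 0.
Proof. by rewrite /cf mcoeffXiM mnmE /=; case: a => // a; rewrite -mmD0 addmK. Qed.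
Lemma cf_X1 p a c b : cf ('X_1 * p) a c b = if c is c'.+1 then cf p a c' b else 0.
Proof. by rewrite /cf mcoeffXiM mnmE /=; case: c => // c; rewrite -mmD1 addmK. Qed.
Lemma cf_X2 p a c b : cf ('X_2%:R * p) a c b = if b is b'.+1 then cf p a c b' else 0.
Proof. by rewrite /cf mcoeffXiM mnmE /=; case: b => // b; rewrite -mmD2 addmK. Qed.

Lemma fstD (u v : E) : (u + v).1 = u.1 + v.1. Proof. by []. Qed.
Lemma sndD (u v : E) : (u + v).2 = u.2 + v.2. Proof. by []. Qed.
Lemma fstZ (x : C) (u : E) : (x *: u).1 = x *: u.1. Proof. by []. Qed.
Lemma sndZ (x : C) (u : E) : (x *: u).2 = x *: u.2. Proof. by []. Qed.

Definition pairE := (fstD, sndD, fstZ, sndZ).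

Lemma diracE k v : dirac k v =
  (dunkl k 0 v.2 + - iC *: dunkl k 1 v.2 + dunkl k 2%:R v.1,
   dunkl k 0 v.1 + iC *: dunkl k 1 v.1 - dunkl k 2%:R v.2).
Proof.
rewrite /dirac 2!big_ord_recl big_ord1.
rewrite (_ : lift ord0 ord0 = 1); last exact: val_inj.
rewrite (_ : lift ord0 _ = 2%:R); last exact: val_inj.
rewrite (_ : ord0 = 0); last exact: val_inj.
set w := _ + _; rewrite [LHS]surjective_pairing /w.
by congr pair; rewrite !pairE /sigma /liftE /= addrA.
Qed.

Lemma iC2 : iC * iC = -1.
Proof. by rewrite -expr2 sqr_i. Qed.

(* The subterms are matched syntactically: unification up to conversion
   would unfold the polynomial operations. *)
Ltac cfrw l H0 := let r := match type of H0 with _ = ?r => r end in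
  let H := fresh in assert (H : l = r) by exact H0;
  pattern l; refine (eq_ind_r _ _ H); cbv beta; clear H.
Ltac cfstep :=
  match goal with |- context [cf ?s ?a ?c ?b] =>
    let l := constr:(cf s a c b) in
    lazymatch s with
    | ?p + ?q => cfrw l (cfD p q a c b)
    | - ?p => cfrw l (cfN p a c b)
    | ?x *: ?p => cfrw l (cfZ x p a c b)
    | 'X_0 * ?p => cfrw l (cf_X0 p a c b)
    | 'X_1 * ?p => cfrw l (cf_X1 p a c b)
    | 'X_2%:R * ?p => cfrw l (cf_X2 p a c b)
    | dunkl ?k 0 ?p => cfrw l (cf_dunkl0 k p a c b)
    | dunkl ?k 1 ?p => cfrw l (cf_dunkl1 k p a c b)
    | dunkl ?k 2%:R ?p => cfrw l (cf_dunkl2 k p a c b)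
    | refl 0 ?p => cfrw l (cf_refl0 p a c b)
    | refl 1 ?p => cfrw l (cf_refl1 p a c b)
    | refl 2%:R ?p => cfrw l (cf_refl2 p a c b)
    end
  end.
Ltac cfnorm := repeat cfstep.

Ltac oddcase := repeat match goal with |- context [odd ?x] => case: (odd x) => /= end.

(* [ring] reduces modulo [h * u = 1] but not modulo [2 * h = 1], hence the
   variable [u] standing for [2]. *)
Lemma halfP : exists u : C, [/\ u = 2%:R, 2%:R^-1 * u = 1 & forall x, exists y, x = u * y].
Proof.
have half2 : 2%:R^-1 * 2%:R = 1 :> C by rewrite mulVf // pnatr_eq0.
exists 2%:R; split=> // x; exists (2%:R^-1 * x).
by rewrite mulrA [_ * 2%:R^-1]mulrC half2 mul1r.
Qed.
Ltac cfring :=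
  let u := fresh "u" in let u2 := fresh "u2" in let hu := fresh "hu" in
  let divu := fresh "divu" in let h := fresh "h" in let j := fresh "j" in
  let jj := fresh "jj" in
  case: halfP => u [u2 hu divu];
  repeat match goal with |- context [cf ?p ?a ?c ?b] =>
    let x := fresh "x" in move: (cf p a c b) => x; case: (divu x) => {}x -> end;
  repeat match goal with |- context [rC ?y] =>
    let x := fresh "x" in move: (rC y) => x end;
  move: (2%:R^-1) hu => h hu; move: iC iC2 => j jj;
  oddcase; ring: hu jj u2.
(** Compared coefficientwise, this is a polynomial identity in the coefficients, the signs and the
    parameters [k]. Zero exponents are split off because multiplication by a variable contributes
    nothing there. *)
Lemma dirac_BIop k g v : dirac k (BIop k g v) = BIop k g (dirac k v).
Proof.
move: g; apply: I3_ind; rewrite !diracE [LHS]surjective_pairing [RHS]surjective_pairing;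
  congr pair; apply: cfP => a c b; rewrite /BIop /=.
- by case: c => [|c]; case: b => [|b]; cfnorm; rewrite /bra !signE /=; cfring.
- by case: c => [|c]; case: b => [|b]; cfnorm; rewrite /bra !signE /=; cfring.
- by case: a => [|a]; case: b => [|b]; cfnorm; rewrite /bra !signE /=; cfring.
- by case: a => [|a]; case: b => [|b]; cfnorm; rewrite /bra !signE /=; cfring.
- by case: a => [|a]; case: c => [|c]; cfnorm; rewrite /bra !signE /=; cfring.
- by case: a => [|a]; case: c => [|c]; cfnorm; rewrite /bra !signE /=; cfring.
Qed.

(** * Extension from the plane x_2 = 0 *)

(* The eigencoordinate of sigma_2 for the eigenvalue [(-1)^s]. *)
Definition psi (s : bool) (v : E) (a c b : nat) : C :=
  cf v.1 a c b - (-1) ^+ s * iC * cf v.2 a c b.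

Lemma fst_psi v a c b : cf v.1 a c b = (psi true v a c b + psi false v a c b) / 2%:R.
Proof. by rewrite /psi; move: (cf v.1 a c b) (cf v.2 a c b) iC => x y j; field. Qed.

Lemma snd_psi v a c b : cf v.2 a c b = - iC * (psi true v a c b - psi false v a c b) / 2%:R.
Proof.
rewrite /psi; move: (cf v.1 a c b) (cf v.2 a c b) iC iC2 => x y j jj.
have -> : - j * (x - (-1) ^+ true * j * y - (x - (-1) ^+ false * j * y)) / 2%:R = - (j * j) * y.
  by field.
by rewrite jj opprK mul1r.
Qed.

Lemma psi_inj u v : (forall s a c b, psi s u a c b = psi s v a c b) -> u = v.
Proof.
move=> uv; rewrite [u]surjective_pairing [v]surjective_pairing.
by congr pair; apply: cfP => a c b; rewrite ?fst_psi ?snd_psi !uv.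
Qed.

Section CK.
Variable k : 'I_3 -> RR.

(* The [(-1)^s]-eigencomponent of the Dirac equation at the monomial
   x_1^a x_2^c x_3^b; note that sigma_1 and sigma_3 exchange the eigenspaces. *)
Definition star (s : bool) (v : E) (a c b : nat) : Prop :=
  bra k 1 c.+1 * psi s v a c.+1 b =
  iC * (bra k 0 a.+1 * psi (~~ s) v a.+1 c b)
  - (-1) ^+ s * (bra k 2%:R b.+1 * psi (~~ s) v a c b.+1).

Lemma star_dirac s v a c b :
  bra k 1 c.+1 * psi s v a c.+1 b -
    (iC * (bra k 0 a.+1 * psi (~~ s) v a.+1 c b)
     - (-1) ^+ s * (bra k 2%:R b.+1 * psi (~~ s) v a c b.+1)) =
  (-1) ^+ s * cf (dirac k v).1 a c b - iC * cf (dirac k v).2 a c b.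
Proof.
rewrite diracE /=; cfnorm; rewrite /psi.
move: (bra _ _ _) (bra _ _ _) (bra _ _ _) (cf v.1 _ _ _) (cf v.1 _ _ _) (cf v.1 _ _ _)
  (cf v.2 _ _ _) (cf v.2 _ _ _) (cf v.2 _ _ _) iC iC2 => b0 b1 b2 p1 p2 p3 q1 q2 q3 j jj.
by case: s => /=; ring: jj.
Qed.

Lemma dirac_star v : dirac k v = 0 <-> forall s a c b, star s v a c b.
Proof.
have cf0 a c b : cf 0 a c b = 0 by apply: mcoeff0.
split=> [Dv s a c b|Sv].
  apply/eqP; rewrite -subr_eq0 star_dirac Dv /= cf0; apply/eqP; ring.
have D (s : bool) a c b : (-1) ^+ s * cf (dirac k v).1 a c b - iC * cf (dirac k v).2 a c b = 0.
  by have := star_dirac s v a c b; rewrite (Sv s a c b) subrr => <-.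
rewrite [LHS]surjective_pairing [RHS]surjective_pairing.
congr pair; apply: cfP => a c b; rewrite cf0; move: (D true a c b) (D false a c b) => /=;
  move: (cf (dirac k v).1 a c b) (cf (dirac k v).2 a c b) iC iC2 => x y j jj E1 E2.
- transitivity ((((-1) ^+ false * x - j * y) - ((-1) ^+ true * x - j * y)) / 2%:R).
    by field.
  by rewrite E1 E2 subrr mul0r.
- transitivity (- (j * j) * y); first by rewrite jj opprK mul1r.
  transitivity (j * (((-1) ^+ false * x - j * y) + ((-1) ^+ true * x - j * y)) / 2%:R).
    by field.
  by rewrite E1 E2 addr0 mulr0 mul0r.
Qed.

Lemma Mn_star n v : Mn k n v <->
  (forall s a c b, (a + c + b)%N != n -> psi s v a c b = 0) /\
  (forall s a c b, star s v a c b).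
Proof.
have hom p : reflect (forall a c b, (a + c + b)%N != n -> cf p a c b = 0) (p \is n.-homog).
  apply: (iffP idP) => [p_hom a c b abc|p0].
    by apply: (dhomog_nemf_coeff p_hom); rewrite /= mdeg_mm.
  apply/dhomogP => m; rewrite mcoeff_msupp; apply: contraNeq => /eqP m_n.
  apply/eqP; rewrite (mmE m); apply: p0; rewrite -mdeg_mm -mmE.
  exact/eqP.
split=> [[/hom h1 /hom h2 /dirac_star S]|[h S]].
  by split=> // s a c b abc; rewrite /psi h1 // h2 // mulr0 subr0.
split; [apply/hom|apply/hom|exact/dirac_star] => a c b abc.
  by rewrite fst_psi !h // addr0 mul0r.
by rewrite snd_psi !h // subr0 mulr0 mul0r.
Qed.
End CK.

Lemma bra0 k i : bra k i 0 = 0.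
Proof. by rewrite /bra expr0 subrr mulr0 addr0. Qed.

Lemma cf_fun n (F : nat -> nat -> nat -> C) : exists p : P,
  forall a c b, cf p a c b = if (a + c + b == n)%N then F a c b else 0.
Proof.
pose G (m : 'X_{1..3}) := if mdeg m == n then F (m 0) (m 1) (m 2%:R) else 0.
exists (\sum_(m : 'X_{1..3 < n.+1}) (G m *: 'X_[m])) => a c b.
have GE : G (mm a c b) = if (a + c + b == n)%N then F a c b else 0.
  by rewrite /G mdeg_mm !mnmE.
rewrite /cf; have [ltn|gen] := ltnP (mdeg (mm a c b)) n.+1.
  by rewrite mcoeff_mpoly.
rewrite raddf_sum big1 => [|m _].
  by case: eqP gen => // abc; rewrite mdeg_mm abc ltnn.
rewrite /= mcoeffZ mcoeffX; case: eqP => [mE|_]; last by rewrite mulr0.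
by have := bmdeg m; rewrite mE ltnNge gen.
Qed.

Section CK2.
Variables (k : 'I_3 -> RR) (n : nat).
Hypothesis bra1_neq0 : forall c, (c < n)%N -> bra k 1 c.+1 != 0.

(** Induction on the exponent of x_2: [star] expresses a coefficient at [c + 1] through two at [c],
    one step further in [a] or in [b]. A step may leave [G] only where its factor [bra] is zero. *)
Lemma psi_vanish v (G : nat -> nat -> bool) : Mn k n v ->
  (forall a b, G a b -> G a.+1 b || (bra k 0 a.+1 == 0)) ->
  (forall a b, G a b -> G a b.+1 || (bra k 2%:R b.+1 == 0)) ->
  (forall s a b, G a b -> (a + b)%N = n -> psi s v a 0 b = 0) ->
  forall s a c b, G a b -> psi s v a c b = 0.
Proof.
move=> /Mn_star[hom S] G0 G2 v0 s a c; elim: c s a => [|c IHc] s a b Gab.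
  have [abn|] := eqVneq (a + b)%N n; first exact: v0.
  by move=> abn; apply: hom; rewrite addn0.
have [abc|] := eqVneq (a + c.+1 + b)%N n; last exact: hom.
have := S s a c b; rewrite /star.
have -> : bra k 0 a.+1 * psi (~~ s) v a.+1 c b = 0.
  by case/orP: (G0 a b Gab) => [/IHc->|/eqP->]; rewrite ?mulr0 ?mul0r.
have -> : bra k 2%:R b.+1 * psi (~~ s) v a c b.+1 = 0.
  by case/orP: (G2 a b Gab) => [/IHc->|/eqP->]; rewrite ?mulr0 ?mul0r.
rewrite !mulr0 subr0 => /eqP; rewrite mulf_eq0 => /orP[|/eqP//].
by rewrite (negPf (bra1_neq0 _)) //; lia.
Qed.

(** The Dirac equation [star] solved for the coefficient with the higher power of x_2. *)
Fixpoint ck_ext (F : bool -> nat -> nat -> C) (c : nat) (s : bool) (a b : nat) : C :=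
  if c is c'.+1 then
    (iC * (bra k 0 a.+1 * ck_ext F c' (~~ s) a.+1 b)
     - (-1) ^+ s * (bra k 2%:R b.+1 * ck_ext F c' (~~ s) a b.+1)) / bra k 1 c
  else F s a b.

(* The Cauchy-Kovalevskaya extension from the plane [x_2 = 0]. *)
Lemma ck_exists (F : bool -> nat -> nat -> C) :
  exists2 v, Mn k n v & forall s a b, (a + b)%N = n -> psi s v a 0 b = F s a b.
Proof.
(* The two components are recovered from the prescribed eigencoordinates as in [fst_psi] and
   [snd_psi]. *)
have [p pE] := cf_fun n (fun a c b => (ck_ext F c true a b + ck_ext F c false a b) / 2%:R).
have [q qE] := cf_fun n
  (fun a c b => - iC * (ck_ext F c true a b - ck_ext F c false a b) / 2%:R).
have psiE s a c b : psi s (p, q) a c b = if (a + c + b == n)%N then ck_ext F c s a b else 0.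
  rewrite /psi pE qE; case: eqP => _; last by rewrite mulr0 subr0.
  move: (ck_ext F c) => f.
  have -> : (f true a b + f false a b) / 2%:R
      - (-1) ^+ s * iC * (- iC * (f true a b - f false a b) / 2%:R)
     = (f true a b + f false a b) / 2%:R
       + (-1) ^+ s * (iC * iC) * ((f true a b - f false a b) / 2%:R) by ring.
  by rewrite iC2; case: s => /=; field.
exists (p, q) => [|s a b abn]; last by rewrite psiE addn0 abn eqxx.
apply/Mn_star; split=> s a c b => [abc|]; first by rewrite psiE (negPf abc).
rewrite /star !psiE !(addSn, addnS); case: eqP => [abc|_]; last by rewrite !mulr0 subr0.
have b1 : bra k 1 c.+1 != 0 by apply: bra1_neq0; lia.
by rewrite /= mulrC divfK.
Qed.
End CK2.

(** * The action of X, Y, Z on coefficients in the plane x_2 = 0 *)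

Section BIformulas.
Variables (k : 'I_3 -> RR) (v : E).
Hypothesis starv : forall s a c b, star k s v a c b.

(** Halving the eigencoordinates makes both components of [v] denominator-free combinations of them,
    which suits [ring]. *)
Let phi s a c b := psi s v a c b / 2%:R.
Let fst_phi a c b : cf v.1 a c b = phi true a c b + phi false a c b.
Proof. by rewrite fst_psi mulrDl. Qed.
Let snd_phi a c b : cf v.2 a c b = - iC * (phi true a c b - phi false a c b).
Proof. by rewrite snd_psi -mulrA mulrBl. Qed.
Let psi_phi s a c b : psi s v a c b = phi s a c b * 2%:R.
Proof. by rewrite divfK // pnatr_eq0. Qed.
Let star_phi s a c b : bra k 1 c.+1 * phi s a c.+1 b =
  iC * (bra k 0 a.+1 * phi (~~ s) a.+1 c b)
  - (-1) ^+ s * (bra k 2%:R b.+1 * phi (~~ s) a c b.+1).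
Proof. by rewrite /phi !mulrA starv; ring. Qed.

Let phi_ind (Q : (bool -> nat -> nat -> nat -> C) -> Prop) :
  (forall f : bool -> nat -> nat -> nat -> C,
    (forall s a c b, bra k 1 c.+1 * f s a c.+1 b =
      iC * (bra k 0 a.+1 * f (~~ s) a.+1 c b)
      - (-1) ^+ s * (bra k 2%:R b.+1 * f (~~ s) a c b.+1)) -> Q f) -> Q phi.
Proof. by apply. Qed.

(** In the plane x_2 T_3 contributes nothing, and the coefficients linear in x_2 produced by x_3 T_2
    are eliminated by [star]. *)
Lemma psi_X s a b : psi s (BIop k 0 v) a 0 b =
  (-1) ^+ b * (bra k 2%:R b + 2%:R^-1 + rC (k 1)) * psi s v a 0 b
  + rC (k 2%:R) * psi s v a 0 b
  + iC * (-1) ^+ s * (-1) ^+ b *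
    (bra k 0 a.+1 * (if b is b'.+1 then psi s v a.+1 0 b' else 0)).
Proof.
rewrite {1}/psi /BIop /=; case: b => [|b]; cfnorm; rewrite !psi_phi ?bra0 !fst_phi !snd_phi;
  elim/phi_ind: phi => f starf; move: iC iC2 starf => j jj starf.
- by rewrite !signE; case: s => /=; ring: jj.
- have := starf true a 0%N b; have := starf false a 0%N b; rewrite !signE /=.
  by case: s => /=; oddcase => H1 H2; first [ring: H1 H2 jj | ring: H2 H1 jj].
Qed.

Lemma psi_Z s a b : psi s (BIop k 2%:R v) a 0 b =
  (-1) ^+ a * (bra k 0 a + 2%:R^-1 + rC (k 1)) * psi s v a 0 b
  + rC (k 0) * psi s v a 0 b
  - iC * (-1) ^+ s * (-1) ^+ a *
    (bra k 2%:R b.+1 * (if a is a'.+1 then psi s v a' 0 b.+1 else 0)).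
Proof.
rewrite {1}/psi /BIop /=; case: a => [|a]; cfnorm; rewrite !psi_phi ?bra0 !fst_phi !snd_phi;
  elim/phi_ind: phi => f starf; move: iC iC2 starf => j jj starf.
- by rewrite !signE; case: s => /=; ring: jj.
- have := starf true a 0%N b; have := starf false a 0%N b; rewrite !signE /=.
  by case: s => /=; oddcase => H1 H2; first [ring: H1 H2 jj | ring: H2 H1 jj].
Qed.

Lemma psi_Y s a b : psi s (BIop k 1 v) a 0 b =
  (-1) ^+ (a + b) * (2%:R^-1 * psi s v a 0 b + iC * (-1) ^+ s *
    (bra k 2%:R b.+1 * (if a is a'.+1 then psi s v a' 0 b.+1 else 0)
     - bra k 0 a.+1 * (if b is b'.+1 then psi s v a.+1 0 b' else 0)))
  + rC (k 2%:R) * ((-1) ^+ a * psi s v a 0 b)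
  + rC (k 0) * ((-1) ^+ b * psi s v a 0 b).
Proof.
rewrite {1}/psi /BIop /=; case: a => [|a]; case: b => [|b]; cfnorm;
  rewrite !psi_phi ?bra0 !fst_phi !snd_phi exprD;
  elim/phi_ind: phi => f starf; move: iC iC2 starf => j jj starf;
  rewrite !signE; case: s => /=; oddcase; ring: jj.
Qed.
End BIformulas.

(** * Submodules *)

(** The six conditions belong in order to x_3 T_2, x_2 T_3, x_1 T_3, x_3 T_1, x_2 T_1, x_1 T_2. Each
    operator reads a coefficient at a shifted exponent, which must lie in [G] or come with factor
    zero. *)
Definition shift_closed (br : 'I_3 -> nat -> C) (G : nat -> nat -> nat -> bool) : Prop :=
  (forall a c b, G a c b.+1 -> G a c.+1 b || (br 1 c.+1 == 0)) /\
  (forall a c b, G a c.+1 b -> G a c b.+1 || (br 2%:R b.+1 == 0)) /\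
  (forall a c b, G a.+1 c b -> G a c b.+1 || (br 2%:R b.+1 == 0)) /\
  (forall a c b, G a c b.+1 -> G a.+1 c b || (br 0 a.+1 == 0)) /\
  (forall a c b, G a c.+1 b -> G a.+1 c b || (br 0 a.+1 == 0)) /\
  (forall a c b, G a.+1 c b -> G a c.+1 b || (br 1 c.+1 == 0)).

Definition vanish_on (G : nat -> nat -> nat -> bool) (v : E) : Prop :=
  forall a c b, G a c b -> cf v.1 a c b = 0 /\ cf v.2 a c b = 0.

Lemma mul_vanish (g : bool) (x y s t : C) :
  g || (x == 0) -> (g -> y = 0) -> x * (s * (t * y)) = 0.
Proof. by case: g => [_ ->//|/eqP-> _]; rewrite ?mulr0 ?mul0r. Qed.

Lemma BIop_vanish_on k G v g : shift_closed (bra k) G -> vanish_on G v ->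
  vanish_on G (BIop k g v).
Proof.
move=> [h1 [h2 [h3 [h4 [h5 h6]]]]] Gv a c b Gabc.
have Gv1 a' c' b' : G a' c' b' -> cf v.1 a' c' b' = 0 by case/Gv.
have Gv2 a' c' b' : G a' c' b' -> cf v.2 a' c' b' = 0 by case/Gv.
move: {Gv}g; apply: I3_ind; rewrite /BIop /=;
  [case: c Gabc => [|c] Gabc; case: b Gabc => [|b] Gabc
  |case: a Gabc => [|a] Gabc; case: b Gabc => [|b] Gabc
  |case: a Gabc => [|a] Gabc; case: c Gabc => [|c] Gabc];
  (split; cfnorm);
  move: (cf v.1) (cf v.2) (bra k) Gv1 Gv2 h1 h2 h3 h4 h5 h6
    => f1 f2 br Gv1 Gv2 h1 h2 h3 h4 h5 h6;
  rewrite ?(Gv1 _ _ _ Gabc) ?(Gv2 _ _ _ Gabc);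
  try rewrite !(mul_vanish _ _ (h1 _ _ _ Gabc) (@Gv1 _ _ _));
  try rewrite !(mul_vanish _ _ (h1 _ _ _ Gabc) (@Gv2 _ _ _));
  try rewrite !(mul_vanish _ _ (h2 _ _ _ Gabc) (@Gv1 _ _ _));
  try rewrite !(mul_vanish _ _ (h2 _ _ _ Gabc) (@Gv2 _ _ _));
  try rewrite !(mul_vanish _ _ (h3 _ _ _ Gabc) (@Gv1 _ _ _));
  try rewrite !(mul_vanish _ _ (h3 _ _ _ Gabc) (@Gv2 _ _ _));
  try rewrite !(mul_vanish _ _ (h4 _ _ _ Gabc) (@Gv1 _ _ _));
  try rewrite !(mul_vanish _ _ (h4 _ _ _ Gabc) (@Gv2 _ _ _));
  try rewrite !(mul_vanish _ _ (h5 _ _ _ Gabc) (@Gv1 _ _ _));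
  try rewrite !(mul_vanish _ _ (h5 _ _ _ Gabc) (@Gv2 _ _ _));
  try rewrite !(mul_vanish _ _ (h6 _ _ _ Gabc) (@Gv1 _ _ _));
  try rewrite !(mul_vanish _ _ (h6 _ _ _ Gabc) (@Gv2 _ _ _));
  rewrite !(mulr0, subr0, sub0r, oppr0, addr0) //.
Qed.

Lemma BIop0 k g : BIop k g 0 = 0.
Proof.
have cf0 a c b : cf 0 a c b = 0 by apply: mcoeff0.
have van : vanish_on (fun _ _ _ => true) (BIop k g 0).
  by apply: BIop_vanish_on; [do ![split]|move=> a c b _; rewrite !cf0].
rewrite [LHS]surjective_pairing; congr pair; apply: cfP => a c b;
  by rewrite cf0; have [] := van a c b isT.
Qed.

Lemma BIop_Mn k n g v : Mn k n v -> Mn k n (BIop k g v).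
Proof.
move=> Mv; have /Mn_star[hom _] := Mv; apply/Mn_star; split; last first.
  by apply/dirac_star; rewrite dirac_BIop; case: Mv => _ _ ->; apply: BIop0.
(* Homogeneity is vanishing off total degree [n], a region stable under the degree-preserving
   operators x_i T_j. *)
have van : vanish_on (fun a c b => (a + c + b)%N != n) v.
  by move=> a c b abc; rewrite fst_psi snd_psi !hom // addr0 subr0 mul0r !mulr0 mul0r.
have shift : shift_closed (bra k) (fun a c b => (a + c + b)%N != n).
  by do ![split] => a c b; rewrite !(addSn, addnS) => ->.
move=> s a c b /(BIop_vanish_on g shift van)[E1 E2].
by rewrite /psi E1 E2 mulr0 subr0.
Qed.

Lemma Mnx_vanish k n (i : 'I_3) t v :
  Mnx k n i t v <-> Mn k n v /\ vanish_on (fun a c b => (mm a c b i < t)%N) v.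
Proof.
split=> -[Mv vt]; split=> //; first by move=> a c b /vt.
by move=> m; rewrite (mmE m) => /vt.
Qed.

Lemma bra_t k (i : 'I_3) t : is_t (k i) t -> bra k i t = 0.
Proof.
case=> t_odd kt; rewrite /bra signE t_odd.
have -> : t%:R = rC t%:R by rewrite /rC rmorph_nat.
have -> : rC t%:R = - (2%:R * rC (k i)) by rewrite -[LHS]opprK -rmorphN -kt rmorphM rmorph_nat.
by ring.
Qed.

(** Only T_i lowers the exponent of x_i, and the critical step from [t] to [t - 1] carries the
    factor [bra k i t = 0]. *)
Lemma BIop_Mnx k n (i : 'I_3) t g v : is_t (k i) t ->
  Mnx k n i t v -> Mnx k n i t (BIop k g v).
Proof.
move=> /bra_t bra_t /Mnx_vanish[Mv vt]; apply/Mnx_vanish; split; first exact: BIop_Mn.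
apply: BIop_vanish_on vt.
have lt_or m : (m < t)%N -> (m.+1 < t)%N || (bra k i m.+1 == 0).
  by rewrite -[(m < t)%N]/(m.+1 <= t)%N leq_eqVlt => /orP[/eqP->|->//]; rewrite bra_t eqxx orbT.
move: i lt_or {bra_t}; apply: I3_ind => lt_or; do ![split] => a c b; rewrite !mnmE /=;
  try (by move=> /lt_or); try (by move=> ->); by move=> /ltnW ->.
Qed.

(** * Monomial bases of the subquotients *)

Lemma psi_lin s (x : C) (u v : E) a c b :
  psi s (x *: u + v) a c b = x * psi s u a c b + psi s v a c b.
Proof.
have E1 : cf (x *: u + v).1 a c b = x * cf u.1 a c b + cf v.1 a c b.
  by rewrite -cfZ; apply: cfD.
have E2 : cf (x *: u + v).2 a c b = x * cf u.2 a c b + cf v.2 a c b.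
  by rewrite -cfZ; apply: cfD.
by rewrite /psi E1 E2; ring.
Qed.

(* [-e (-1)^j alpha_j] is the coefficient along which the raising operator
   moves coordinate [j] to [j+1]; rescaling turns it into [1]. *)
Fixpoint scale (alpha : nat -> C) (e : C) (j : nat) : C :=
  if j is i.+1 then scale alpha e i / (- e * (-1) ^+ i * alpha i) else 1.

Lemma scale_neq0 alpha e d : e != 0 -> (forall j, (j < d)%N -> alpha j != 0) ->
  forall j, (j <= d)%N -> scale alpha e j != 0.
Proof.
move=> e0 al0; elim=> [|j IHj] jd /=; first exact: oner_neq0.
by rewrite mulf_neq0 ?IHj ?(ltnW jd) // invr_neq0 // !mulf_neq0 ?oppr_eq0 ?signr_eq0 // al0.
Qed.

(** Multiplied out, [Z] is tridiagonal with the off-diagonal entries of [X] and [Y] up to sign. This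
    is the shape of the operator Y on plane monomials. *)
Lemma fZ_tridiag d a b c u i : fZ d a b c u i =
  ((-1) ^+ i * (c + d%:R / 2%:R + 2%:R^-1) - 2%:R^-1) * u i
  - (-1) ^+ i * Ophi d a b c i.+1 * u i.+1
  + (if i is j.+1 then (-1) ^+ i * u j else 0).
Proof.
case: i => [|i]; rewrite /fZ /fX /fY /Otheta /Ophi ?signE /=; first by field.
by case: (odd i) => /=; field.
Qed.

(** * Rescaling monomial coordinates to the basis of O_d *)

Section Model.
Variables (d : nat) (a b c e : C) (alpha beta u wX wY wZ : nat -> C).
Hypothesis ee : e * e = -1.
Hypothesis alpha_neq0 : forall j, (j < d)%N -> alpha j != 0.
Hypothesis phiE : forall j, (j < d)%N -> Ophi d a b c j.+1 = beta j * alpha j.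
Hypothesis phi_last : Ophi d a b c d.+1 = 0.
Hypothesis beta_last : beta d * u d.+1 = 0.
Hypothesis wXE : forall j, (j <= d)%N -> wX j = Otheta d a j * u j
  + (if j is i.+1 then e * (-1) ^+ j * (alpha i * u i) else 0).
Hypothesis wZE : forall j, (j <= d)%N -> wZ j = Otheta d b j * u j
  + e * (-1) ^+ j * (beta j * u j.+1).
Hypothesis wYE : forall j, (j <= d)%N -> wY j =
  ((-1) ^+ j * (c + d%:R / 2%:R + 2%:R^-1) - 2%:R^-1) * u j
  - e * (beta j * u j.+1) + (if j is i.+1 then e * (alpha i * u i) else 0).

(** Rescaling turns the raising entries into 1 and moves them into the lowering entries, which
    become [beta j * alpha j], that is [phi_(j+1)]. *)
Let s := scale alpha e.
Let y j := s j * u j.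

Let e_neq0 : e != 0.
Proof. by apply: contra_eq_neq ee => ->; rewrite mul0r eq_sym oppr_eq0 oner_neq0. Qed.

Let sS j : (j < d)%N -> s j = - (e * (-1) ^+ j * alpha j) * s j.+1.
Proof.
move=> jd; rewrite /s /= mulrC mulNr mulNr divfK // oppr_eq0.
by rewrite !mulf_neq0 ?signr_eq0 // alpha_neq0.
Qed.

Let raise j : (j <= d)%N -> Ophi d a b c j.+1 * (s j.+1 * u j.+1) =
  s j * (e * (-1) ^+ j * (beta j * u j.+1)).
Proof.
rewrite leq_eqVlt => /orP[/eqP->|jd]; first by rewrite phi_last beta_last mul0r !mulr0.
rewrite phiE // (sS jd).
transitivity (- (e * e) * ((-1) ^+ j * (-1) ^+ j) * (beta j * alpha j * (s j.+1 * u j.+1))).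
  by rewrite ee opprK mul1r -expr2 sqrr_sign mul1r.
by ring.
Qed.

Let lower i : (i < d)%N -> s i * u i = s i.+1 * (e * (-1) ^+ i.+1 * (alpha i * u i)).
Proof. by move=> id; rewrite (sS id) exprS; ring. Qed.

Lemma model_X j : (j <= d)%N -> fX d a y j = s j * wX j.
Proof.
move=> jd; rewrite wXE // /fX /y; case: j jd => [|j] jd; first by ring.
by rewrite (lower jd); ring.
Qed.

Lemma model_Y j : (j <= d)%N -> fY d a b c y j = s j * wZ j.
Proof. by move=> jd; rewrite wZE // /fY /y raise //; ring. Qed.

Lemma model_Z j : (j <= d)%N -> fZ d a b c y j = s j * wY j.
Proof.
move=> jd; have := raise jd; rewrite wYE // fZ_tridiag /y.
move: (s j.+1 * u j.+1) (Ophi d a b c j.+1) => z f fz.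
have sq : (-1) ^+ j * (-1) ^+ j = 1 :> C by rewrite -expr2 sqrr_sign.
case: j jd sq fz => [|j] jd sq fz; first by rewrite !addr0 expr0 in fz *; ring: fz.
by rewrite (lower jd); ring: fz sq.
Qed.
End Model.

(** A uniform description by plane coefficients: suitable regions [G] give M_n, M_n(x_1), M_n(x_3),
    their intersection, and 0. *)
Definition VG k n (G : nat -> nat -> bool) (v : E) : Prop :=
  Mn k n v /\ forall s a b, G a b -> psi s v a 0 b = 0.

Lemma VG_Mn k n v : Mn k n v <-> VG k n (fun _ _ => false) v.
Proof. by split=> [|[]]. Qed.

Section Regions.
Variables (k : 'I_3 -> RR) (n t1 t3 : nat).
Hypothesis bra1_neq0 : forall c, (c < n)%N -> bra k 1 c.+1 != 0.
Hypothesis t1P : is_t (k 0) t1.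
Hypothesis t3P : is_t (k 2%:R) t3.

Let psi_cf v a c b : (forall s, psi s v a c b = 0) -> cf v.1 a c b = 0 /\ cf v.2 a c b = 0.
Proof. by move=> v0; rewrite fst_psi snd_psi !v0 subr0 addr0 mulr0 mul0r. Qed.

(** Vanishing for [a < t1] in the plane spreads to all powers of x_2, since the step leaving the
    region has factor [bra k 0 t1 = 0]. *)
Lemma VG_M1 v : Mnx k n 0 t1 v <-> VG k n (fun a _ => a < t1)%N v.
Proof.
split=> [/Mnx_vanish[Mv vt]|[Mv vt]].
  split=> // s a b at1; have [|E1 E2] := vt a 0%N b; first by rewrite mnmE.
  by rewrite /psi E1 E2 mulr0 subr0.
apply/Mnx_vanish; split=> // a c b; rewrite mnmE => at1; apply: psi_cf => s.
apply: (psi_vanish bra1_neq0 Mv (G := fun a _ => a < t1)%N) => // [a' b'|a' b' ->//|s' a' b' ? _]; last exact: vt.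
by rewrite -[(a' < t1)%N]/(a'.+1 <= t1)%N leq_eqVlt => /orP[/eqP->|->//]; rewrite bra_t // eqxx orbT.
Qed.

Lemma VG_M3 v : Mnx k n 2%:R t3 v <-> VG k n (fun _ b => b < t3)%N v.
Proof.
split=> [/Mnx_vanish[Mv vt]|[Mv vt]].
  split=> // s a b bt3; have [|E1 E2] := vt a 0%N b; first by rewrite mnmE.
  by rewrite /psi E1 E2 mulr0 subr0.
apply/Mnx_vanish; split=> // a c b; rewrite mnmE => bt3; apply: psi_cf => s.
apply: (psi_vanish bra1_neq0 Mv (G := fun _ b => b < t3)%N) => // [a' b' ->//|a' b'|s' a' b' ? _]; last exact: vt.
by rewrite -[(b' < t3)%N]/(b'.+1 <= t3)%N leq_eqVlt => /orP[/eqP->|->//]; rewrite bra_t // eqxx orbT.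
Qed.

Lemma VG_M13 v : (Mnx k n 0 t1 v /\ Mnx k n 2%:R t3 v) <->
  VG k n (fun a b => (a < t1) || (b < t3))%N v.
Proof.
split=> [[/VG_M1[Mv v1] /VG_M3[_ v3]]|[Mv v13]].
  by split=> // s a b /orP[/v1|/v3].
by split; [apply/VG_M1|apply/VG_M3]; split=> // s a b ab; apply: v13; rewrite ab ?orbT.
Qed.

(** Uniqueness of the Cauchy-Kovalevskaya extension. *)
Lemma VG_0 v : v = 0 <-> VG k n (fun _ _ => true) v.
Proof.
have cf0 a c b : cf 0 a c b = 0 by apply: mcoeff0.
have psi0 s a c b : psi s 0 a c b = 0 by rewrite /psi !cf0 mulr0 subr0.
split=> [->|[Mv v0]].
  split=> //; apply/Mn_star; split=> // s a c b.
  by rewrite /star !psi0 !mulr0 subr0.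
apply: psi_inj => s a c b; rewrite psi0.
by apply: (psi_vanish bra1_neq0 Mv (G := fun _ _ => true)) => // s' a' b' _ _; apply: v0.
Qed.

(** Coordinates on V/U are the plane coefficients in [GU] outside [GV], enumerated by [A], [B] with
    inverse [idx]. The two eigenspaces of sigma_2 give the two summands of [dsum2]. *)
Lemma subquot_VG (V U : E -> Prop) GV GU d (A B : nat -> nat) (idx : nat -> nat -> nat)
    (W : 'I_3 -> 'M[C]_d.+1) (sc : bool -> nat -> C) :
  (forall v, V v <-> VG k n GV v) -> (forall v, U v <-> VG k n GU v) ->
  (forall g v, V v -> V (BIop k g v)) ->
  (forall j, (j <= d)%N -> [/\ (A j + B j)%N = n, GU (A j) (B j),
     ~~ GV (A j) (B j) & idx (A j) (B j) = j]) ->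
  (forall a b, (a + b)%N = n -> GU a b -> ~~ GV a b ->
     [/\ (idx a b <= d)%N, A (idx a b) = a & B (idx a b) = b]) ->
  (forall a b, GV a b -> GU a b) ->
  (forall s j, (j <= d)%N -> sc s j != 0) ->
  (forall g v s, V v -> vecn d (fun j => sc s j * psi s (BIop k g v) (A j) 0 (B j)) =
     W g *m vecn d (fun j => sc s j * psi s v (A j) 0 (B j))) ->
  subquot_iso k V U (dsum2 W).
Proof.
move=> VP UP VB AB AB_idx GVU sc0 VW; split=> //.
pose y v s := vecn d (fun j => sc s j * psi s v (A j) 0 (B j)).
have y0P v s : y v s = 0 <-> forall j, (j <= d)%N -> psi s v (A j) 0 (B j) = 0.
  split=> [/colP y0 j jd|y0]; last first.
    by apply/colP => j; rewrite !mxE y0 ?mulr0 // -ltnS.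
  have := y0 (inord j); rewrite !mxE inordK // => /eqP.
  by rewrite mulf_eq0 (negPf (sc0 s j jd)) /= => /eqP.
exists (fun v => col_mx (y v true) (y v false)); split.
- move=> x u v _ _; rewrite scale_col_mx add_col_mx.
  by congr col_mx; apply/colP => j; rewrite !mxE psi_lin; ring.
- move=> w.
  pose ws (s : bool) := if s then usubmx w else dsubmx w.
  (* Plane data for a preimage of [w]: zero on [GV], the unscaled coordinates of [w] elsewhere; its
     extension lies in [V]. *)
  pose F s a b := if GV a b then 0 else
    ws s (inord (idx a b)) 0 / sc s (idx a b).
  have [v Mv vF] := ck_exists bra1_neq0 F.
  exists v.
    apply/VP; split=> // s a b Gab; have [abn|] := eqVneq (a + b)%N n.
      by rewrite vF // /F Gab.
    by move=> abn; have /Mn_star[hom _] := Mv; apply: hom; rewrite addn0.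
  rewrite -[RHS]vsubmxK; congr col_mx; apply/colP => -[j jd];
    have [ABn _ /negPf GVj idxj] := AB j jd; rewrite mxE vF // /F GVj idxj;
    by rewrite mulrC divfK ?sc0 //; congr (_ _ _); apply: val_inj; rewrite /= inordK.
- move=> v /VP[Mv vV]; split=> [E0|/UP[_ vU]].
    have y0 s : y v s = 0.
      by move: E0; rewrite -col_mx0 => /eq_col_mx[]; case: s.
    apply/UP; split=> // s a b Gab; have [abn|abn] := eqVneq (a + b)%N n; last first.
      by have /Mn_star[hom _] := Mv; apply: hom; rewrite addn0.
    have [GVab|GVab] := boolP (GV a b); first exact: vV.
    have [jd Aj Bj] := AB_idx a b abn Gab GVab.
    by have /y0P/(_ _ jd) := y0 s; rewrite Aj Bj.
  have y0 s : y v s = 0.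
    by apply/y0P => j jd; have [_ GUj _ _] := AB j jd; apply: vU.
  by rewrite !y0 col_mx0.
- move=> g v Vv; rewrite /dsum2 mul_block_col !mul0mx addr0 add0r.
  by rewrite /y !VW.
Qed.
End Regions.

(** Serves W_1 and W_2 at once: coordinate [j] belongs to x_1^(n-b0-j) x_3^(b0+j), [eta] is the
    parity sign of [b0], and [e] is a square root of -1 depending on the eigenspace of sigma_2. The
    two final conditions cut the string at its ends. *)
Lemma intertwineA n d b0 a b c (eta e r0 r1 r2 : C) eps (A B : nat -> C)
    (P : 'I_3 -> nat -> nat -> C) (f : nat -> nat -> C) :
  (forall a b, P 0 a b = (-1) ^+ b * (B b + 2%:R^-1 + r1) * f a b + r2 * f a b
     + e * (-1) ^+ b * (A a.+1 * (if b is b'.+1 then f a.+1 b' else 0))) ->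
  (forall a b, P 2%:R a b = (-1) ^+ a * (A a + 2%:R^-1 + r1) * f a b + r0 * f a b
     - e * (-1) ^+ a * (B b.+1 * (if a is a'.+1 then f a' b.+1 else 0))) ->
  (forall a b, P 1 a b = (-1) ^+ (a + b) * (2%:R^-1 * f a b + e *
       (B b.+1 * (if a is a'.+1 then f a' b.+1 else 0)
        - A a.+1 * (if b is b'.+1 then f a.+1 b' else 0)))
     + r2 * ((-1) ^+ a * f a b) + r0 * ((-1) ^+ b * f a b)) ->
  e * e = -1 ->
  ~~ odd n -> ~~ odd d -> (b0 + d < n)%N ->
  (-1) ^+ b0 = eta -> eps 0 = eta -> eps 1 = - eta -> eps 2%:R = -1 ->
  (forall j, (j < d)%N -> A (n - b0 - j)%N != 0) ->
  (forall j, (j < d)%N -> Ophi d a b c j.+1 = B (b0 + j).+1 * A (n - b0 - j)%N) ->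
  (forall j, (j <= d)%N -> Otheta d a j =
     (-1) ^+ j * (B (b0 + j)%N + 2%:R^-1 + r1) + eta * r2) ->
  (forall j, (j <= d)%N -> Otheta d b j =
     - (-1) ^+ j * (A (n - b0 - j)%N + 2%:R^-1 + r1) - eta * r0) ->
  c + d%:R / 2%:R + 2%:R^-1 = - eta * (r0 + r2) ->
  (forall b', b0 = b'.+1 -> f (n - b0).+1 b' = 0) ->
  B (b0 + d).+1 * f (n - b0 - d.+1)%N (b0 + d).+1 = 0 ->
  let sc := scale (fun j => A (n - b0 - j)%N) e in
  forall g,
    vecn d (fun j => sc j * P g (n - b0 - j)%N (b0 + j)%N) =
    twist eps s23 (Omod d a b c) g
      *m vecn d (fun j => sc j * f (n - b0 - j)%N (b0 + j)%N).
Proof.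
move=> hX hZ hY ee n_even d_even b0dn etaE eps0 eps1 eps2 al0 phiE thE thsE cE v_first v_last sc.
have eta2 : eta * eta = 1 by rewrite -etaE -expr2 sqrr_sign.
have sgnb j : (-1) ^+ (b0 + j) = eta * (-1) ^+ j by rewrite exprD etaE.
have sgna j : (j <= d)%N -> (-1) ^+ (n - b0 - j) = eta * (-1) ^+ j.
  move=> jd; rewrite -sgnb -subnDA signE oddB; last by lia.
  by rewrite (negPf n_even) signE.
pose alpha j := A (n - b0 - j)%N; pose beta j := B (b0 + j).+1.
pose u j := f (n - b0 - j)%N (b0 + j)%N.
have uE j : u j = f (n - b0 - j)%N (b0 + j)%N by [].
pose wX j := eta * P 0 (n - b0 - j)%N (b0 + j)%N.
pose wZ j := - eta * P 2%:R (n - b0 - j)%N (b0 + j)%N.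
pose wY j := - P 1 (n - b0 - j)%N (b0 + j)%N.
have sq (j : nat) : (-1) ^+ j * (-1) ^+ j = 1 :> C by rewrite -expr2 sqrr_sign.
have predb j : (j <= d)%N -> A (n - b0 - j).+1 *
    (if (b0 + j)%N is b'.+1 then f (n - b0 - j).+1 b' else 0) =
    (if j is i.+1 then alpha i * u i else 0).
  case: j => [|j] jd.
    rewrite addn0 subn0; move: v_first; move: (n - b0)%N => m.
    by case: (b0) => [|b'] v_first; rewrite ?v_first ?mulr0.
  rewrite addnS (_ : (n - b0 - j.+1).+1 = (n - b0 - j)%N) //; lia.
have preda j : (j <= d)%N ->
    (if (n - b0 - j)%N is a'.+1 then f a' (b0 + j).+1 else 0) = u j.+1.
  move=> jd; rewrite uE addnS (_ : (n - b0 - j)%N = (n - b0 - j.+1).+1) //; lia.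
have wXE j : (j <= d)%N -> wX j = Otheta d a j * u j
    + (if j is i.+1 then e * (-1) ^+ j * (alpha i * u i) else 0).
  move=> jd; rewrite /wX hX // predb // thE // sgnb -uE.
  by case: j jd => [|j] jd; ring: eta2.
have wZE j : (j <= d)%N -> wZ j = Otheta d b j * u j
    + e * (-1) ^+ j * (beta j * u j.+1).
  move=> jd; rewrite /wZ hZ // preda // thsE // sgna // -uE -/(beta j).
  by ring: eta2.
have wYE j : (j <= d)%N -> wY j =
  ((-1) ^+ j * (c + d%:R / 2%:R + 2%:R^-1) - 2%:R^-1) * u j
  - e * (beta j * u j.+1) + (if j is i.+1 then e * (alpha i * u i) else 0).
  move=> jd; rewrite /wY hY // predb // preda // exprD sgnb sgna // cE -uE -/(beta j).
  move: (sq j) => sqj.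
  by case: j jd sqj => [|j] jd sqj; ring: eta2 sqj.
have v_last' : beta d * u d.+1 = 0 by rewrite /beta uE addnS.
have phi_last := Ophi_last a b c d_even.
have scE j : sc j = scale alpha e j by [].
apply: I3_ind; rewrite /twist -scalemxAl Omod_vecn //=.
- rewrite eps0; apply/colP => j; rewrite !mxE.
  rewrite (model_X (alpha := alpha) (u := u) ee al0 wXE) ?leq_ord // /wX.
  by rewrite scE; ring: eta2.
- rewrite eps2; apply/colP => j; rewrite !mxE.
  rewrite (model_Z (alpha := alpha) (beta := beta) (u := u) ee al0 phiE phi_last v_last' wYE) ?leq_ord // /wY.
  by rewrite scE; ring.
- rewrite eps1; apply/colP => j; rewrite !mxE.
  rewrite (model_Y (alpha := alpha) (beta := beta) (u := u) ee al0 phiE phi_last v_last' wZE) ?leq_ord // /wZ.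
  by rewrite scE; ring: eta2.
Qed.

(** The counterpart for W_3, with x_1 and x_3 exchanged: coordinate [j] belongs to x_1^j x_3^(n-j),
    and the exchange replaces [e] by [- e]. At the lower end there is no neighbour. *)
Lemma intertwineB n d a b c (e r0 r1 r2 : C) (A B : nat -> C)
    (P : 'I_3 -> nat -> nat -> C) (f : nat -> nat -> C) :
  (forall a b, P 0 a b = (-1) ^+ b * (B b + 2%:R^-1 + r1) * f a b + r2 * f a b
     + e * (-1) ^+ b * (A a.+1 * (if b is b'.+1 then f a.+1 b' else 0))) ->
  (forall a b, P 2%:R a b = (-1) ^+ a * (A a + 2%:R^-1 + r1) * f a b + r0 * f a b
     - e * (-1) ^+ a * (B b.+1 * (if a is a'.+1 then f a' b.+1 else 0))) ->
  (forall a b, P 1 a b = (-1) ^+ (a + b) * (2%:R^-1 * f a b + e *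
       (B b.+1 * (if a is a'.+1 then f a' b.+1 else 0)
        - A a.+1 * (if b is b'.+1 then f a.+1 b' else 0)))
     + r2 * ((-1) ^+ a * f a b) + r0 * ((-1) ^+ b * f a b)) ->
  e * e = -1 ->
  ~~ odd n -> ~~ odd d -> (d < n)%N ->
  (forall j, (j < d)%N -> B (n - j)%N != 0) ->
  (forall j, (j < d)%N -> Ophi d a b c j.+1 = A j.+1 * B (n - j)%N) ->
  (forall j, (j <= d)%N -> Otheta d a j = (-1) ^+ j * (A j + 2%:R^-1 + r1) + r0) ->
  (forall j, (j <= d)%N -> Otheta d b j =
     - (-1) ^+ j * (B (n - j)%N + 2%:R^-1 + r1) - r2) ->
  c + d%:R / 2%:R + 2%:R^-1 = - (r0 + r2) ->
  A d.+1 * f d.+1 (n - d.+1)%N = 0 ->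
  let sc := scale (fun j => B (n - j)%N) (- e) in
  forall g,
    vecn d (fun j => sc j * P g j (n - j)%N) =
    twist eps_p1m1 s123 (Omod d a b c) g *m vecn d (fun j => sc j * f j (n - j)%N).
Proof.
move=> hX hZ hY ee n_even d_even dn al0 phiE thE thsE cE v_last sc.
have nee : - e * - e = -1 by rewrite mulrNN.
have sgnb j : (j <= d)%N -> (-1) ^+ (n - j) = (-1) ^+ j :> C.
  by move=> jd; rewrite signE oddB ?(negPf n_even) ?signE //; lia.
pose alpha j := B (n - j)%N; pose beta j := A j.+1.
pose u j := f j (n - j)%N; have uE j : u j = f j (n - j)%N by [].
pose wX j := P 2%:R j (n - j)%N; pose wZ j := - P 0 j (n - j)%N.
pose wY j := - P 1 j (n - j)%N.
have sq (j : nat) : (-1) ^+ j * (-1) ^+ j = 1 :> C by rewrite -expr2 sqrr_sign.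
have preda j : (j <= d)%N -> B (n - j).+1 *
    (if j is a'.+1 then f a' (n - j).+1 else 0) =
    (if j is i.+1 then alpha i * u i else 0).
  case: j => [|j] jd; first by rewrite mulr0.
  rewrite (_ : (n - j.+1).+1 = (n - j)%N) //; lia.
have predb j : (j <= d)%N ->
    (if (n - j)%N is b'.+1 then f j.+1 b' else 0) = u j.+1.
  move=> jd; rewrite uE (_ : (n - j)%N = (n - j.+1).+1) //; lia.
have wXE j : (j <= d)%N -> wX j = Otheta d a j * u j
    + (if j is i.+1 then - e * (-1) ^+ j * (alpha i * u i) else 0).
  move=> jd; rewrite /wX hZ // preda // thE // -uE.
  by case: j jd => [|j] jd; ring.
have wZE j : (j <= d)%N -> wZ j = Otheta d b j * u j
    + - e * (-1) ^+ j * (beta j * u j.+1).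
  move=> jd; rewrite /wZ hX // predb // thsE // sgnb // -uE -/(beta j).
  by ring.
have wYE j : (j <= d)%N -> wY j =
  ((-1) ^+ j * (c + d%:R / 2%:R + 2%:R^-1) - 2%:R^-1) * u j
  - - e * (beta j * u j.+1) + (if j is i.+1 then - e * (alpha i * u i) else 0).
  move=> jd; rewrite /wY hY // predb // preda // exprD sgnb // cE -uE -/(beta j).
  move: (sq j) => sqj.
  by case: j jd sqj => [|j] jd sqj; ring: sqj.
have phi_last := Ophi_last a b c d_even.
have scE j : sc j = scale alpha (- e) j by [].
apply: I3_ind; rewrite /twist -scalemxAl Omod_vecn //=.
- rewrite /eps_p1m1 /=; apply/colP => j; rewrite !mxE.
  rewrite (model_Y (alpha := alpha) (beta := beta) (u := u) nee al0 phiE phi_last v_last wZE) ?leq_ord // /wZ.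
  by rewrite scE; ring.
- rewrite /eps_p1m1 /=; apply/colP => j; rewrite !mxE.
  rewrite (model_Z (alpha := alpha) (beta := beta) (u := u) nee al0 phiE phi_last v_last wYE) ?leq_ord // /wY.
  by rewrite scE; ring.
- rewrite /eps_p1m1 /=; apply/colP => j; rewrite !mxE.
  rewrite (model_X (alpha := alpha) (u := u) nee al0 wXE) ?leq_ord // /wX.
  by rewrite scE; ring.
Qed.

(** * The parameters of the theorem *)

Lemma rCD x y : rC (x + y) = rC x + rC y. Proof. exact: rmorphD. Qed.
Lemma rCN x : rC (- x) = - rC x. Proof. exact: rmorphN. Qed.
Lemma rCM x y : rC (x * y) = rC x * rC y. Proof. exact: rmorphM. Qed.
Lemma rC_nat m : rC m%:R = m%:R. Proof. exact: rmorph_nat. Qed.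
Lemma rC_inj : injective rC. Proof. exact: fmorph_inj. Qed.
Lemma rC_neq0 x : x != 0 -> rC x != 0. Proof. by move=> x0; rewrite /rC fmorph_eq0. Qed.

Lemma is_t_C ki t : is_t ki t -> t%:R = - (2%:R * rC ki) :> C.
Proof. by case=> _ /(congr1 rC); rewrite rCM rCN !rC_nat => ->; rewrite opprK. Qed.

(** Since [2 k_i = -t], the value is [m - t] for odd [m] and [m] for even [m]. *)
Lemma bra_gt k i t m : is_t (k i) t -> (t < m)%N -> bra k i m != 0.
Proof.
move=> [t_odd kt] tm.
have -> : bra k i m = rC (if odd m then m%:R - t%:R else m%:R).
  rewrite /bra signE; case: (odd m); rewrite ?rCD ?rCN !rC_nat; last by ring.
  by rewrite (is_t_C (conj t_odd kt)); ring.
apply: rC_neq0; case: (odd m); first by rewrite subr_eq0 eqr_nat gtn_eqF.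
by rewrite pnatr_eq0; lia.
Qed.

(** A zero would occur at an odd [c + 1] equal to [-2 k_i], making [c + 1] an admissible [t]. The
    hypothesis covers finite and infinite [t_i] alike. *)
Lemma bra_neq0 k i n : (forall t, is_t (k i) t -> (n < t)%N) ->
  forall c, (c < n)%N -> bra k i c.+1 != 0.
Proof.
move=> no_t c cn; have -> : bra k i c.+1 = rC (if odd c.+1 then c.+1%:R + 2%:R * k i else c.+1%:R).
  by rewrite /bra signE; case: (odd c.+1); rewrite ?rCD ?rCM !rC_nat; ring.
apply: rC_neq0; case: ifP => [c_odd|_]; last by rewrite pnatr_eq0.
apply/eqP => /eqP; rewrite addrC addr_eq0 => /eqP kc.
by have /no_t := conj c_odd kc; rewrite ltnNge cn.
Qed.

(** Here [theta_l = (-1)^l (r + l)], and positivity of [r] makes the absolute values strictly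
    increasing. *)
Lemma Otheta_inj d a r : 0 < r -> a - d%:R / 2%:R = rC r ->
  forall i j, (i <= d)%N -> (j <= d)%N -> Otheta d a i = Otheta d a j -> i = j.
Proof.
move=> r0 ar i j _ _.
have OE l : Otheta d a l = rC ((-1) ^+ l * (r + l%:R)).
  rewrite /Otheta !rCM !rCD -ar rC_nat /rC rmorphXn rmorphN rmorph1.
  by field.
rewrite !OE => /rC_inj/(congr1 (fun x => `|x|)).
have pos l : 0 <= r + l%:R by rewrite addr_ge0 ?ler0n // Order.POrderTheory.ltW.
rewrite !normrM !normr_sign !mul1r (ger0_norm (pos i)) (ger0_norm (pos j)).
by move/addrI/eqP; rewrite eqr_nat => /eqP.
Qed.

(** * The subquotients W_1, W_2, W_3 *)

Section Quotients.
Variables (k : 'I_3 -> RR) (n t1 t3 : nat).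
Hypothesis n_even : ~~ odd n.
Hypothesis t1P : is_t (k 0) t1.
Hypothesis t3P : is_t (k 2%:R) t3.
Hypothesis t13n : (t1 + t3 <= n)%N.
Hypothesis k1P : forall t, is_t (k 1) t -> (n < t)%N.
Let K : C := rC (k 0) + rC (k 1) + rC (k 2%:R).
Let N : C := (n%:R + 1) / 2%:R.

Let t1_odd : odd t1. Proof. by case: t1P. Qed.
Let t3_odd : odd t3. Proof. by case: t3P. Qed.
Let t1_gt0 : (0 < t1)%N. Proof. by apply: odd_gt0. Qed.
Let t3_gt0 : (0 < t3)%N. Proof. by apply: odd_gt0. Qed.
Let t1C := is_t_C t1P.
Let t3C := is_t_C t3P.
Let bra1_neq0 := bra_neq0 k1P.

Lemma iCs2 (s : bool) : (iC * (-1) ^+ s) * (iC * (-1) ^+ s) = -1 :> C.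
Proof.
transitivity ((iC * iC) * ((-1) ^+ s * (-1) ^+ s) : C); first by ring.
by rewrite iC2 -expr2 sqrr_sign mulr1.
Qed.

Lemma iCs_neq0 (s : bool) : iC * (-1) ^+ s != 0 :> C.
Proof. by apply: contra_eq_neq (iCs2 s) => ->; rewrite mul0r eq_sym oppr_eq0 oner_neq0. Qed.

Lemma subquot_W1 :
  subquot_iso k (fun v => Mnx k n 0 t1 v /\ Mnx k n 2%:R t3 v) (fun v => v = 0)
    (dsum2 (twist eps_m1p1 s23 (Omod (n - t1 - t3) (rC (k 0) + rC (k 1) + N)
       (- rC (k 1) - rC (k 2%:R) - N) (- N)))).
Proof.
have dC : (n - t1 - t3)%:R = n%:R - t1%:R - t3%:R :> C by rewrite !natrB //; lia.
have d_even : ~~ odd (n - t1 - t3) by rewrite !oddB; try lia; rewrite t1_odd t3_odd (negPf n_even).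
have alpha0 j : (j < n - t1 - t3)%N -> bra k 0 (n - t3 - j) != 0.
  by move=> jd; apply: bra_gt t1P _; lia.
(* The remaining monomials have [a >= t1] and [b >= t3]; they are listed by increasing [b] from
   [t3]. *)
apply: (subquot_VG bra1_neq0 (A := fun j => (n - t3 - j)%N) (B := fun j => (t3 + j)%N)
  (idx := fun a b => (b - t3)%N)
  (sc := fun s => scale (fun j => bra k 0 (n - t3 - j)) (iC * (-1) ^+ s))
  (VG_M13 bra1_neq0 t1P t3P) (VG_0 bra1_neq0)) => //.
- by move=> g v [v1 v3]; split; apply: BIop_Mnx.
- by move=> j jd; split=> //; lia.
- by move=> a b abn _; split; lia.
- by move=> s j jd; apply: scale_neq0 jd => //; apply: iCs_neq0.
move=> g v s /(VG_M13 bra1_neq0 t1P t3P)[/Mn_star[_ starv] v13].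
apply: (intertwineA (n := n) (A := bra k 0) (B := bra k 2%:R) (eta := -1)
  (P := fun g a b => psi s (BIop k g v) a 0 b) (f := fun a b => psi s v a 0 b)
  (psi_X starv s) (psi_Z starv s) (psi_Y starv s) (iCs2 s)) => //.
- by lia.
- by rewrite signE t3_odd.
- by rewrite opprK.
- move=> j jd; rewrite /Ophi /bra !signE dC !natrB; try lia.
  rewrite -!subnDA oddB; last by lia.
  have -> : (t3 + j).+1%:R = t3%:R + j%:R + 1 :> C by rewrite -addn1 !natrD.
  rewrite /= !oddD t3_odd (negPf n_even) /= t1C t3C /N.
  by case: (odd j) => /=; field.
- move=> j jd; rewrite /Otheta /bra !signE dC oddD t3_odd natrD t1C t3C /N.
  by case: (odd j) => /=; field.
- move=> j jd; rewrite /Otheta /bra !signE dC !natrB; try lia.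
  rewrite -!subnDA oddB; last by lia.
  rewrite oddD t3_odd (negPf n_even) t1C t3C /N.
  by case: (odd j) => /=; field.
- by rewrite dC t1C t3C /N; field.
- by move=> b' t3E; apply: v13; rewrite t3E ltnSn orbT.
(* The monomial after the last has x_1-exponent [t1 - 1], so its coefficient vanishes. *)
- by rewrite v13 ?mulr0 //; lia.
Qed.

(** Both quotients in (ii) involve exactly the plane monomials with [b < t3]: for these [a = n - b]
    exceeds [t1], so the condition on [a] excludes none. *)
Lemma subquot_W2 V U GV GU :
  (forall v, V v <-> VG k n GV v) -> (forall v, U v <-> VG k n GU v) ->
  (forall g v, V v -> V (BIop k g v)) ->
  (forall j, (j < t3)%N -> GU (n - j)%N j && ~~ GV (n - j)%N j) ->
  (forall a b, GU a b -> ~~ GV a b -> (b < t3)%N) ->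
  (forall a b, GV a b -> GU a b) ->
  subquot_iso k V U (dsum2 (twist eps_p1m1 s23 (Omod (t3 - 1)
    (rC (k 1)) (- K - n%:R - 1) (- rC (k 0))))).
Proof.
move=> VP UP VB Gj Gt3 GVU.
have dC : (t3 - 1)%:R = t3%:R - 1 :> C by rewrite natrB.
have d_even : ~~ odd (t3 - 1) by rewrite oddB // t3_odd.
have dS : (t3 - 1).+1 = t3 by lia.
have alpha0 j : (j < t3 - 1)%N -> bra k 0 (n - 0 - j) != 0.
  by move=> jd; apply: bra_gt t1P _; lia.
apply: (subquot_VG bra1_neq0 (A := fun j => (n - 0 - j)%N) (B := fun j => j)
  (idx := fun a b => b)
  (sc := fun s => scale (fun j => bra k 0 (n - 0 - j)) (iC * (-1) ^+ s))
  VP UP VB) => //.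
- move=> j jd; rewrite subn0; have /Gj/andP[Gj1 Gj2] : (j < t3)%N by lia.
  by split=> //; lia.
- by move=> a b abn GUab /(Gt3 _ _ GUab) bt3; split; lia.
- by move=> s j jd; apply: scale_neq0 jd => //; apply: iCs_neq0.
move=> g v s /VP[/Mn_star[_ starv] vV].
apply: (intertwineA (n := n) (b0 := 0) (A := bra k 0) (B := bra k 2%:R) (eta := 1)
  (P := fun g a b => psi s (BIop k g v) a 0 b) (f := fun a b => psi s v a 0 b)
  (psi_X starv s) (psi_Z starv s) (psi_Y starv s) (iCs2 s)) => //.
- by lia.
- move=> j jd; rewrite subn0 /Ophi /bra !signE dC natrB; last by lia.
  rewrite oddB; last by lia.
  rewrite /= (negPf n_even) t3C /K.
  by case: (odd j) => /=; field.
- move=> j jd; rewrite /Otheta /bra !signE dC t3C.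
  by case: (odd j) => /=; field.
- move=> j jd; rewrite subn0 /Otheta /bra !signE dC natrB; last by lia.
  rewrite oddB; last by lia.
  rewrite (negPf n_even) t3C /K.
  by case: (odd j) => /=; field.
- by rewrite dC t3C; field.
(* Here the string ends because T_3 x_3^(t_3) = 0. *)
- by rewrite add0n dS (bra_t t3P) mul0r.
Qed.

Lemma subquot_W3 V U GV GU :
  (forall v, V v <-> VG k n GV v) -> (forall v, U v <-> VG k n GU v) ->
  (forall g v, V v -> V (BIop k g v)) ->
  (forall j, (j < t1)%N -> GU j (n - j)%N && ~~ GV j (n - j)%N) ->
  (forall a b, GU a b -> ~~ GV a b -> (a < t1)%N) ->
  (forall a b, GV a b -> GU a b) ->
  subquot_iso k V U (dsum2 (twist eps_p1m1 s123 (Omod (t1 - 1)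
    (rC (k 1)) (- K - n%:R - 1) (- rC (k 2%:R))))).
Proof.
move=> VP UP VB Gj Gt1 GVU.
have dC : (t1 - 1)%:R = t1%:R - 1 :> C by rewrite natrB.
have d_even : ~~ odd (t1 - 1) by rewrite oddB // t1_odd.
have dS : (t1 - 1).+1 = t1 by lia.
have alpha0 j : (j < t1 - 1)%N -> bra k 2%:R (n - j) != 0.
  by move=> jd; apply: bra_gt t3P _; lia.
apply: (subquot_VG bra1_neq0 (A := fun j => j) (B := fun j => (n - j)%N)
  (idx := fun a b => a)
  (sc := fun s => scale (fun j => bra k 2%:R (n - j)) (- (iC * (-1) ^+ s)))
  VP UP VB) => //.
- move=> j jd; have /Gj/andP[Gj1 Gj2] : (j < t1)%N by lia.
  by split=> //; lia.
- by move=> a b abn GUab /(Gt1 _ _ GUab) at1; split; lia.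
- by move=> s j jd; apply: scale_neq0 jd => //; rewrite oppr_eq0 iCs_neq0.
move=> g v s /VP[/Mn_star[_ starv] vV].
apply: (intertwineB (n := n) (A := bra k 0) (B := bra k 2%:R)
  (P := fun g a b => psi s (BIop k g v) a 0 b) (f := fun a b => psi s v a 0 b)
  (psi_X starv s) (psi_Z starv s) (psi_Y starv s) (iCs2 s)) => //.
- by lia.
- move=> j jd; rewrite /Ophi /bra !signE dC natrB; last by lia.
  rewrite oddB; last by lia.
  rewrite /= (negPf n_even) t1C /K.
  by case: (odd j) => /=; field.
- move=> j jd; rewrite /Otheta /bra !signE dC t1C.
  by case: (odd j) => /=; field.
- move=> j jd; rewrite /Otheta /bra !signE dC natrB; last by lia.
  rewrite oddB; last by lia.
  rewrite (negPf n_even) t1C /K.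
  by case: (odd j) => /=; field.
- by rewrite dC t1C; field.
- by rewrite dS (bra_t t1P) mul0r.
Qed.

End Quotients.

(** * Irreducibility at the parameters of the theorem *)

Lemma irreducible_untwist m eps (s : 'I_3 -> 'I_3) (A : 'I_3 -> 'M[C]_m) :
  mx_irreducible (twist eps s A) -> mx_irreducible A.
Proof.
move=> [m_gt0 irrA]; split=> // Q Q0 Qlin QA; apply: irrA => // g u Qu.
by rewrite /twist -scalemxAl -[_ *: _]addr0; apply: Qlin => //; apply: QA.
Qed.

Lemma eps_p1m1_neq0 g : eps_p1m1 g != 0.
Proof. by rewrite /eps_p1m1; case: ifP; rewrite ?oppr_eq0 oner_neq0. Qed.
Lemma eps_m1p1_neq0 g : eps_m1p1 g != 0.
Proof. by rewrite /eps_m1p1; case: ifP; rewrite ?oppr_eq0 oner_neq0. Qed.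
Lemma s23K : cancel s23 s23. Proof. by apply: I3_ind; apply: val_inj. Qed.

Section Irreducible.
Variables (n : nat) (k2 : RR).
Hypothesis k2_ge0 : 0 <= k2.

(** W_2 and W_3 are reached through this module: its first parameter K+n+1 separates the eigenvalues
    of [X], whereas with first parameter [k_2] they may coincide. *)
Lemma irreducible_source (kx ky : RR) (tx ty : nat) :
  is_t kx tx -> is_t ky ty -> (tx + ty <= n)%N ->
  mx_irreducible (Omod (ty - 1) (rC kx + rC k2 + rC ky + n%:R + 1) (rC kx) (rC k2)).
Proof.
move=> txP tyP tn; have [ty_odd kyE] := tyP; have [tx_odd kxE] := txP.
have ty_gt0 : (0 < ty)%N by apply: odd_gt0.
have txC := is_t_C txP; have tyC := is_t_C tyP.
have dC : (ty - 1)%:R = ty%:R - 1 :> C by rewrite natrB.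
have tnR : tx%:R + ty%:R <= n%:R :> RR by rewrite -natrD ler_nat.
have ty1 : 1 <= ty%:R :> RR by rewrite ler1n.
have tx0 : 0 <= tx%:R :> RR by rewrite ler0n.
have k22 : 0 <= 2%:R * k2 by apply: mulr_ge0.
apply: Omod_irreducible => [|i /andP[i0 id]|i /andP[i0 id]|].
- by rewrite oddB // ty_odd.
- have i0R : 1 <= i%:R :> RR by rewrite ler1n.
  have idR : i%:R + 1 <= ty%:R :> RR by rewrite natr1 ler_nat; lia.
  (* Eliminating [kx] and [ky] through [tx] and [ty] leaves real factors that are nonzero by
     [i < ty], [tx + ty <= n] and [k2 >= 0]. *)
  rewrite (_ : Ophi _ _ _ _ _ = rC (if odd i then (ty%:R - i%:R) * (n%:R + 1 + i%:R - tx%:R - ty%:R)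
     else - (i%:R * (n%:R + 1 + i%:R - tx%:R - ty%:R + 2%:R * k2)))).
    apply: rC_neq0; case: (odd i).
      by apply: mulf_neq0; apply/eqP => H0; lra.
    by rewrite oppr_eq0; apply: mulf_neq0; apply/eqP => H0; lra.
  by rewrite /Ophi dC; case: (odd i); rewrite !(rCD, rCN, rCM, rC_nat) txC tyC; field.
- have i0R : 1 <= i%:R :> RR by rewrite ler1n.
  have idR : i%:R + 1 <= ty%:R :> RR by rewrite natr1 ler_nat; lia.
  rewrite (_ : Ophi _ _ _ _ _ = rC (if odd i then (i%:R - ty%:R) * (n%:R + 1 - i%:R)
     else i%:R * (n%:R + 1 - i%:R + 2%:R * k2))).
    by apply: rC_neq0; case: (odd i); apply: mulf_neq0; apply/eqP => H0; lra.
  by rewrite /Ophi dC; case: (odd i); rewrite !(rCD, rCN, rCM, rC_nat) tyC; field.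
- apply: (Otheta_inj (r := kx + k2 + 2%:R * ky + n%:R + 3%:R / 2%:R)); first by lra.
  rewrite dC !(rCD, rCM, rC_nat) tyC.
  have -> : rC (2%:R^-1) = 2%:R^-1 by rewrite /rC fmorphV rmorph_nat.
  by field.
Qed.

Lemma irreducible_W1 (k1 k3 : RR) (t1 t3 : nat) (N : C := (n%:R + 1) / 2%:R) :
  ~~ odd n -> is_t k1 t1 -> is_t k3 t3 -> (t1 + t3 <= n)%N ->
  mx_irreducible (Omod (n - t1 - t3) (rC k1 + rC k2 + N) (- rC k2 - rC k3 - N) (- N)).
Proof.
move=> n_even t1P t3P tn; have [t1_odd k1E] := t1P; have [t3_odd k3E] := t3P.
have t1C := is_t_C t1P; have t3C := is_t_C t3P.
have dC : (n - t1 - t3)%:R = n%:R - t1%:R - t3%:R :> C by rewrite !natrB //; lia.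
have tnR : t1%:R + t3%:R <= n%:R :> RR by rewrite -natrD ler_nat.
have t10 : 0 <= t1%:R :> RR by rewrite ler0n.
have t30 : 0 <= t3%:R :> RR by rewrite ler0n.
have k22 : 0 <= 2%:R * k2 by apply: mulr_ge0.
apply: Omod_irreducible => [|i /andP[i0 id]|i /andP[i0 id]|].
- by rewrite !oddB; try lia; rewrite t1_odd t3_odd (negPf n_even).
- have i0R : 1 <= i%:R :> RR by rewrite ler1n.
  have idR : i%:R + t1%:R + t3%:R <= n%:R :> RR by rewrite -!natrD ler_nat; lia.
  rewrite (_ : Ophi _ _ _ _ _ = rC (if odd i then (n%:R - t1%:R - t3%:R + 1 - i%:R) * (i%:R + t3%:R)
     else i%:R * (n%:R - t3%:R + 1 - i%:R))).
    by apply: rC_neq0; case: (odd i); apply: mulf_neq0; apply/eqP => H0; lra.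
  by rewrite /Ophi dC /N; case: (odd i); rewrite !(rCD, rCN, rCM, rC_nat) t1C t3C; field.
- have i0R : 1 <= i%:R :> RR by rewrite ler1n.
  have idR : i%:R + t1%:R + t3%:R <= n%:R :> RR by rewrite -!natrD ler_nat; lia.
  (* Unlike the values before, those of the flipped module contain [k2]; its sign keeps the factors
     away from zero. *)
  rewrite (_ : Ophi _ _ _ _ _ = rC (if odd i
     then (i%:R - (n%:R - t1%:R - t3%:R) - 1)
        * (n%:R - t1%:R - t3%:R + 1 - i%:R + 2%:R * k2 + n%:R + 1)
     else i%:R * (n%:R - t1%:R - t3%:R + 1 - i%:R + 2%:R * k2))).
    by apply: rC_neq0; case: (odd i); apply: mulf_neq0; apply/eqP => H0; lra.
  by rewrite /Ophi dC /N; case: (odd i); rewrite !(rCD, rCN, rCM, rC_nat) t1C t3C; field.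
- apply: (Otheta_inj (r := k2 - k3 + 1 / 2%:R)); first by lra.
  rewrite dC !(rCD, rCM, rCN, rC_nat) t1C t3C /N.
  have -> : rC (2%:R^-1) = 2%:R^-1 by rewrite /rC fmorphV rmorph_nat.
  have -> : rC 1 = 1 by exact: rmorph1.
  by field.
Qed.
End Irreducible.

(** * Assembling the subquotients, irreducibility and isomorphisms *)

Theorem theorem8p12 (k1 k2 k3 : RR) (n t1 t3 : nat) :
  ~~ odd n ->
  is_t k1 t1 -> is_t k3 t3 ->
  (t1 + t3 <= n)%N ->
  (forall t2 : nat, is_t k2 t2 -> (n < t2)%N) ->
  let k := kfun k1 k2 k3 in
  let K : C := rC k1 + rC k2 + rC k3 in
  let N : C := (n%:R + 1) / 2%:R in
  let M := Mn k n in
  let M1 := Mnx k n 0 t1 in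
  let M3 := Mnx k n 2%:R t3 in
  let M13 := fun v => M1 v /\ M3 v in
  let W1 := twist eps_m1p1 s23
              (Omod (n - t1 - t3) (rC k1 + rC k2 + N) (- rC k2 - rC k3 - N) (- N)) in
  let W2 := twist eps_p1m1 s23
              (Omod (t3 - 1) (rC k2) (- K - n%:R - 1) (- rC k1)) in
  let W3 := twist eps_p1m1 s123
              (Omod (t1 - 1) (rC k2) (- K - n%:R - 1) (- rC k3)) in
  [/\ subquot_iso k M13 (fun v => v = 0) (dsum2 W1),
      subquot_iso k M1 M13 (dsum2 W2) /\ subquot_iso k M M3 (dsum2 W2),
      subquot_iso k M3 M13 (dsum2 W3) /\ subquot_iso k M M1 (dsum2 W3) &
      (0 <= k2)%R ->
      [/\ mx_irreducible W1, mx_irreducible W2 & mx_irreducible W3] /\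
      [/\ mx_iso W1 (Omod (n - t1 - t3) (- rC k1 - rC k2 - N) N (- rC k2 - rC k3 - N)),
          mx_iso W2 (Omod (t3 - 1) (rC k2) (rC k1) (K + n%:R + 1)) &
          mx_iso W3 (Omod (t1 - 1) (K + n%:R + 1) (rC k3) (rC k2))]].
Proof.
move=> n_even t1P t3P tn k2P k K N M M1 M3 M13 W1 W2 W3.
have b1 := bra_neq0 (k := k) (i := 1) k2P.
have VM := VG_Mn k n; have VM1 := VG_M1 (k := k) b1 t1P.
have VM3 := VG_M3 (k := k) b1 t3P; have VM13 := VG_M13 (k := k) b1 t1P t3P.
have cM g v : M v -> M (BIop k g v) by apply: BIop_Mn.
have cM1 g v : M1 v -> M1 (BIop k g v) by apply: BIop_Mnx.
have cM3 g v : M3 v -> M3 (BIop k g v) by apply: BIop_Mnx.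
split.
- exact: subquot_W1.
- split.
  + apply: (subquot_W2 n_even t1P t3P tn k2P VM1 VM13) => // [j jt|a b|a b ->//].
      by rewrite jt orbT /=; lia.
    by case/orP => // ->.
  + by apply: (subquot_W2 n_even t1P t3P tn k2P VM VM3) => // j ->.
- split.
  + apply: (subquot_W3 n_even t1P t3P tn k2P VM3 VM13) => // [j jt|a b|a b ->].
    * by rewrite jt /=; lia.
    * by case/orP => // ->.
    * by rewrite orbT.
  + by apply: (subquot_W3 n_even t1P t3P tn k2P VM VM1) => // j ->.
move=> k2_ge0.
have d1_even : ~~ odd (n - t1 - t3).
  by case: t1P t3P => t1o _ [t3o _]; rewrite !oddB; try lia; rewrite t1o t3o (negPf n_even).
have d2_even : ~~ odd (t3 - 1) by case: t3P => t3o _; rewrite oddB ?odd_gt0 // t3o.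
have d3_even : ~~ odd (t1 - 1) by case: t1P => t1o _; rewrite oddB ?odd_gt0 // t1o.
have irr1 : mx_irreducible W1.
  exact: (irreducible_twist s23K eps_m1p1_neq0 (irreducible_W1 k2_ge0 n_even t1P t3P tn)).
(* The module underlying W_2 is first proved irreducible in its (1 2 3)-twist, which receives a map
   from an irreducible module; untwisting and twisting by (2 3) then gives W_2. *)
have [S2 S2_n0 S2P] := Omod_hom_p1m1_s123 (rC k2) (- K - n%:R - 1) (- rC k1) d2_even.
have src2 : mx_irreducible
    (Omod (t3 - 1) (- (- K - n%:R - 1)) (- - rC k1) (rC k2)).
  rewrite opprK (_ : - (- K - n%:R - 1) = rC k1 + rC k2 + rC k3 + n%:R + 1); last by rewrite /K; ring.
  exact: (irreducible_source k2_ge0 t1P t3P tn).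
have S2_unit := irreducible_hom_src src2 S2_n0 S2P.
have irrO2 : mx_irreducible (twist eps_p1m1 s123
    (Omod (t3 - 1) (rC k2) (- K - n%:R - 1) (- rC k1))).
  by apply: irreducible_iso src2; exists S2.
have irr2 : mx_irreducible W2.
  exact: (irreducible_twist s23K eps_p1m1_neq0 (irreducible_untwist irrO2)).
have [S3 S3_n0 S3P] := Omod_hom_p1m1_s123 (rC k2) (- K - n%:R - 1) (- rC k3) d3_even.
have src3 : mx_irreducible
    (Omod (t1 - 1) (- (- K - n%:R - 1)) (- - rC k3) (rC k2)).
  rewrite opprK (_ : - (- K - n%:R - 1) = rC k3 + rC k2 + rC k1 + n%:R + 1); last by rewrite /K; ring.
  by apply: (irreducible_source k2_ge0 t3P t1P); rewrite addnC.
have S3_unit := irreducible_hom_src src3 S3_n0 S3P.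
have irr3 : mx_irreducible W3 by apply: irreducible_iso src3; exists S3.
split; split=> //.
- have [S S_n0 SP] := Omod_hom_m1p1_s23 (rC k1 + rC k2 + N) (- rC k2 - rC k3 - N) (- N) d1_even.
  rewrite (_ : - rC k1 - rC k2 - N = - (rC k1 + rC k2 + N)); last by ring.
  rewrite -{2}[N]opprK.
  exact: mx_iso_sym (irreducible_hom_tgt irr1 S_n0 SP) SP.
- have [S S_n0 SP] := Omod_hom_p1m1_s23 (rC k2) (- K - n%:R - 1) (- rC k1) d2_even.
  rewrite (_ : K + n%:R + 1 = - (- K - n%:R - 1)); last by ring.
  rewrite -[rC k1 in X in mx_iso _ X]opprK.
  exact: mx_iso_sym (irreducible_hom_tgt irr2 S_n0 SP) SP.
(* W_3 is itself the (1 2 3)-twist, so the inverse of [S3] is already the required isomorphism. *)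
- rewrite (_ : K + n%:R + 1 = - (- K - n%:R - 1)); last by ring.
  have := mx_iso_sym S3_unit S3P; rewrite opprK; exact.
Qed.
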